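(* Let $\mathscr{J}$ be a Jacobi matrix with parameters $a_n\in\mathbb{R}$, $b_n>0$ ($n\ge0$) for which $\sum_{n=0}^\infty b_n^{-1}<\infty$. Suppose there is a fixed integer $k$ such that all solutions $(u_n)_{n=0}^\infty$ of $$b_nu_{n+1}+a_nu_n+b_{n-1}u_{n-1}=0,\qquad n\ge1,$$ satisfy $$u_n=\mathrm{O}\big(b_{n+k}^{-\frac12}\big),\qquad n\to\infty.$$ Then $\mathscr{J}$ is in limit circle case and the order $\rho$ of its Nevanlinna matrix $W$ is equal to the convergence exponent of $(b_n)_{n=0}^\infty$. If, additionally, $\sum_{n=0}^\infty b_n^{-\rho}<\infty$, then $W$ is of finite type with respect to its order.
   Context: The Jacobi matrix $\mathscr{J}$ is the semi-infinite symmetric tridiagonal matrix with diagonal $(a_0,a_1,\dots)$ and off-diagonal $(b_0,b_1,\dots)$, where $a_n\in\mathbb{R}$, $b_n>0$. It is in limit circle case if its minimal operator in $\ell^2$ is symmetric with deficiency indices $(1,1)$ (as opposed to self-adjoint, the limit point case). Let $p_n,q_n$ be the orthogonal polynomials of the first and second kind, i.e. the solutions of $b_nu_{n+1}+a_nu_n+b_{n-1}u_{n-1}=zu_n$, $n\ge1$, with $p_0=1$, $p_1(z)=(z-a_0)/b_0$, $q_0=0$, $q_1=1/b_0$. In limit circle case, the Nevanlinna matrix $W=\begin{pmatrix}A&C\\ B&D\end{pmatrix}$ consists of the entire functions $$A(z)=z\sum_{n=0}^\infty q_n(0)q_n(z),\quad B(z)=-1+z\sum_{n=0}^\infty q_n(0)p_n(z),$$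 $$C(z)=1+z\sum_{n=0}^\infty p_n(0)q_n(z),\quad D(z)=z\sum_{n=0}^\infty p_n(0)p_n(z).$$ All four entries $w_{ij}$ of $W$ have the same order $\rho:=\limsup_{r\to\infty}\frac{\log\log\max_{|z|=r}|w_{ij}(z)|}{\log r}$, called the order of $W$. $W$ is of finite type with respect to its order if $\limsup_{r\to\infty}r^{-\rho}\log\max_{|z|=r}|w_{ij}(z)|<\infty$ for its entries. The convergence exponent of a sequence $(\lambda_n)$ of nonzero numbers is $\inf\{\alpha>0 : \sum_n|\lambda_n|^{-\alpha}<\infty\}$. *)

(* Defs.v *)
From HB Require Import structures.
From mathcomp Require Import all_boot all_order all_algebra.
From mathcomp Require Import all_classical all_reals all_analysis.
From mathcomp Require Import complex.
Set Implicit Arguments.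
Unset Strict Implicit.
Unset Printing Implicit Defensive.
Import Order.TTheory GRing.Theory Num.Theory.
Import numFieldNormedType.Exports ComplexField.Normc.
Local Open Scope classical_set_scope.
Local Open Scope ring_scope.
Local Open Scope complex_scope.

Section SequenceSpace.
Variable R : realType.
Implicit Types (u v x y : nat -> R[i]) (z : R[i]) (e : R).

(* The norm topology of [R[i]] is carried by its alias [R[i]^o]. *)
Definition csum u : R[i] := limn (series (u : nat -> R[i]^o)).

Definition sqnorm u : \bar R := (\sum_(0 <= n <oo) (normc (u n) ^+ 2)%:E)%E.

Definition ell2 : set (nat -> R[i]) := [set u | (sqnorm u < +oo)%E].

Definition inner u v : R[i] := csum (fun n => u n * (v n)^*).

(* Operators in l^2 are represented by their graphs. *)
Definition graph := set ((nat -> R[i]) * (nat -> R[i])).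
Implicit Type T : graph.

Definition graph_closure T : graph :=
  [set p | [/\ ell2 p.1, ell2 p.2 & forall e, 0 < e ->
     exists2 q, T q &
       (sqnorm (p.1 \- q.1)%R < e%:E)%E /\ (sqnorm (p.2 \- q.2)%R < e%:E)%E]].

Definition densely_defined T :=
  forall x, ell2 x -> forall e, 0 < e ->
    exists2 q, T q & (sqnorm (x \- q.1)%R < e%:E)%E.

Definition adjoint T : graph :=
  [set p | [/\ ell2 p.1, ell2 p.2 &
     forall q, T q -> inner q.2 p.1 = inner q.1 p.2]].

(* Single-valuedness of T is a consequence: if (0, y) is in T, then y is
   orthogonal to the dense domain of T. *)
Definition symmetric_op T := densely_defined T /\ T `<=` adjoint T.

Definition has_dim (V : set (nat -> R[i])) (d : nat) :=
  exists f : 'I_d -> nat -> R[i],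
    [/\ forall i, V (f i),
        forall c : 'I_d -> R[i],
          (forall n, \sum_i c i * f i n = 0) -> forall i, c i = 0
      & forall u, V u ->
          exists c : 'I_d -> R[i], forall n, u n = \sum_i c i * f i n].

Definition adjoint_eigenspace T z : set (nat -> R[i]) :=
  [set u | adjoint T (u, fun n => z * u n)].

Definition deficiency_indices T (m n : nat) :=
  has_dim (adjoint_eigenspace T 'i) m /\
  has_dim (adjoint_eigenspace T (- 'i)) n.

End SequenceSpace.

Section Jacobi.
Variable R : realType.
Variables a b : nat -> R.
Implicit Types (u x : nat -> R[i]) (z : R[i]).

Definition jacobi_action u : nat -> R[i] := fun n =>
  (b n)%:C * u n.+1 + (a n)%:C * u n +
  (if n is m.+1 then (b m)%:C * u m else 0).

Definition finitely_supported u := exists N, forall n, (N <= n)%N -> u n = 0.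

Definition minimal_operator : graph R :=
  graph_closure [set p | finitely_supported p.1 /\ p.2 = jacobi_action p.1].

Definition limit_circle :=
  symmetric_op minimal_operator /\ deficiency_indices minimal_operator 1 1.

Definition recurrence_solution z u := forall n, (1 <= n)%N ->
  (b n)%:C * u n.+1 + (a n)%:C * u n + (b n.-1)%:C * u n.-1 = z * u n.

Fixpoint solution_pair z (c0 c1 : R[i]) (n : nat) : R[i] * R[i] :=
  if n is m.+1 then
    let: (v, w) := solution_pair z c0 c1 m in
    (w, ((z - (a m.+1)%:C) * w - (b m)%:C * v) / (b m.+1)%:C)
  else (c0, c1).

Definition solution_from z (c0 c1 : R[i]) : nat -> R[i] :=
  fun n => (solution_pair z c0 c1 n).1.

Lemma solution_fromP z (c0 c1 : R[i]) : (forall n, 0 < b n) ->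
  [/\ solution_from z c0 c1 0 = c0, solution_from z c0 c1 1 = c1
    & recurrence_solution z (solution_from z c0 c1)].
Proof.
move=> b_gt0; split=> // -[//|n] _; rewrite /solution_from /=.
case: (solution_pair z c0 c1 n) => v w /=.
have bn0 : (b n.+1)%:C != 0 by rewrite fmorph_eq0 gt_eqF.
by rewrite mulrCA divff// mulr1 mulrBl addrAC addrNK subrK.
Qed.

Definition orthopoly1 n z := solution_from z 1 ((z - (a 0)%:C) / (b 0)%:C) n.
Definition orthopoly2 n z := solution_from z 0 (b 0)%:C^-1 n.

Local Notation p := orthopoly1.
Local Notation q := orthopoly2.

Definition nevanlinnaA z := z * csum (fun n => q n 0 * q n z).
Definition nevanlinnaB z := -1 + z * csum (fun n => q n 0 * p n z).
Definition nevanlinnaC z := 1 + z * csum (fun n => p n 0 * q n z).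
Definition nevanlinnaD z := z * csum (fun n => p n 0 * p n z).

Definition nevanlinna_matrix z : 'M[R[i]]_2 :=
  \matrix_(i < 2, j < 2)
    if i == 0 then (if j == 0 then nevanlinnaA z else nevanlinnaC z)
    else (if j == 0 then nevanlinnaB z else nevanlinnaD z).

End Jacobi.

Section Growth.
Variable R : realType.
Implicit Types (f : R[i] -> R[i]) (W : R[i] -> 'M[R[i]]_2) (rho : R).

Definition max_modulus f (r : R) : R :=
  sup [set normc (f z) | z in [set z | normc z = r]].

(* [ln] is 0 on nonpositive reals; for the unbounded entire functions
   considered here the arguments of both [ln] are positive for large r. *)
Definition growth_order f : \bar R :=
  limf_esup (fun r : R => (ln (ln (max_modulus f r)) / ln r)%:E) +oo.

Definition finite_type_wrt rho f :=
  (limf_esup (fun r : R => (r `^ (- rho) * ln (max_modulus f r))%:E)%R +oo%R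
     < +oo)%E.

Definition matrix_order W rho :=
  forall i j, growth_order (fun z => W z i j) = rho%:E.

Definition matrix_finite_type W rho :=
  forall i j, finite_type_wrt rho (fun z => W z i j).

Definition convergence_exponent (lambda : nat -> R) : \bar R :=
  ereal_inf [set alpha%:E | alpha in [set alpha : R | 0 < alpha /\
    cvgn (series (fun n => `|lambda n| `^ (- alpha)))]].

End Growth.

(* Main.v *)
Require Import Defs.
From HB Require Import structures.
From mathcomp Require Import all_boot all_order all_algebra.
From mathcomp Require Import all_classical all_reals all_analysis.
From mathcomp Require Import complex.
From mathcomp Require Import ring lra zify.
Import Order.TTheory GRing.Theory Num.Theory.
Import numFieldNormedType.Exports ComplexField.Normc.
Local Open Scope classical_set_scope.
Local Open Scope ring_scope.
Set Implicit Arguments.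
Unset Strict Implicit.
Unset Printing Implicit Defensive.

(** Let [p] and [q] be the two real solutions of the recurrence at [z = 0]. A
solution [u] at [z] is determined by its Wronskians [X] and [Y] with [p] and [q],
and these satisfy [X n.+1 = X n + z * p n * u n], [Y n.+1 = Y n + z * q n * u n]
with [u n = q n * X n - p n * Y n] ([canonical_sol]). For the orthogonal
polynomials of the first and second kind, [X] and [Y] converge to the four entries
of the Nevanlinna matrix ([orthopoly1_canonical], [orthopoly2_canonical]).

Upper bound. One step multiplies [normc X + normc Y] by at most
[1 + normc z * jump n] ([canonical_sol_ub]), where [jump n] is comparable to
[p n ^+ 2 + q n ^+ 2] and thus is [O(1 / b (n + k))] by hypothesis ([jump_le]). As
[ln (1 + x)] is at most a multiple of [x `^ al] for [0 < al <= 1], summability of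
[b `^ (- al)] bounds the entries by [expR (K * normc z `^ al)]
([prod_le_expR], [canon_ub]). This gives one inequality for the order, and the type.

Limit circle case. The flux [F n], the imaginary part of [(X n)^* * Y n], increases
at each step by the imaginary part of [z] times [normc (u n) ^+ 2] ([flux_step]), so
boundedness of [X] and [Y] makes the solutions at ['i] and at [- 'i] square summable
([canon_ell2]). Since the adjoint of the minimal operator acts as the Jacobi matrix,
its eigenspaces are then spanned by the polynomials of the first kind
([adjoint_eigenspace_dim1]).

Lower bound. For [z = 'i * r] the constancy of the Wronskian of [p] and [q] gives
[F n.+1 = b n * flux (u n) (u n.+1)], whence [F n.+2 >= F n + 2 * r / b n * F n.+1].
Therefore [F n * F n.+1] gains a factor [1 + 2 * r / b n] at every step
([flux_growth]), and no monotonicity of [b] is needed. As the flux is at most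
[normc X * normc Y] and also controls the increments of [X] and [Y], both [X] and [Y]
are large ([canonical_sol_lb]). So for every entry the sums of [ln (1 + 2 * r / b j)]
are at most four times the logarithm of the maximum modulus, up to a constant. If the
order were smaller than the convergence exponent [rho], these sums would be
[O(r `^ c)] with [c < rho], and [b `^ (- be)] would be summable for some [be < rho]
([dyadic_summable]). *)

(** * Modulus of complex numbers *)

Section ComplexModulus.
Local Open Scope complex_scope.
Variable R : realType.
Implicit Types (x y z : R[i]).

Lemma sqr_normcE z : normc z ^+ 2 = complex.Re z ^+ 2 + complex.Im z ^+ 2.
Proof. by case: z => x y; rewrite /normc/= sqr_sqrtr// addr_ge0// sqr_ge0. Qed.

Lemma normc_ge0 z : 0 <= normc z.
Proof. by case: z => x y; rewrite /normc/= sqrtr_ge0. Qed.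

Lemma normc_real (t : R) : normc t%:C = `|t|.
Proof. by rewrite /normc/= expr0n/= addr0 sqrtr_sqr. Qed.

Lemma normc_conj z : normc z^* = normc z.
Proof. by case: z => x y; rewrite /normc/= sqrrN. Qed.

Lemma normcD z w : normc (z + w) <= normc z + normc w.
Proof. exact: le_normcD. Qed.

Lemma normc_opp z : normc (- z) = normc z.
Proof. exact: normcN. Qed.

Lemma normcB z w : normc (z - w) <= normc z + normc w.
Proof. by rewrite -[normc w]normc_opp normcD. Qed.

Lemma normc_dist z w : normc (z - w) = normc (w - z).
Proof. by rewrite -normc_opp opprB. Qed.

Lemma normc_sum (I : Type) (s : seq I) (F : I -> R[i]) :
  normc (\sum_(i <- s) F i) <= \sum_(i <- s) normc (F i).
Proof.
elim: s => [|i s IHs]; first by rewrite !big_nil normc0.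
by rewrite !big_cons (le_trans (normcD _ _))// lerD2l.
Qed.

Lemma ler_norm_sqr (s t : R) : 0 <= t -> s ^+ 2 <= t ^+ 2 -> `|s| <= t.
Proof.
move=> t0 st; rewrite -sqrtr_sqr -[leRHS]ger0_norm// -sqrtr_sqr.
exact: ler_wsqrtr.
Qed.

Lemma normc_Re z : `|complex.Re z| <= normc z.
Proof. by rewrite ler_norm_sqr ?normc_ge0// sqr_normcE lerDl sqr_ge0. Qed.

Lemma normc_Im z : `|complex.Im z| <= normc z.
Proof. by rewrite ler_norm_sqr ?normc_ge0// sqr_normcE lerDr sqr_ge0. Qed.

(** The imaginary part of [x^* * y], written out in coordinates. *)
Definition flux x y : R :=
  complex.Re x * complex.Im y - complex.Im x * complex.Re y.

Lemma flux_le x y : `|flux x y| <= normc x * normc y.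
Proof.
rewrite ler_norm_sqr ?mulr_ge0 ?normc_ge0// exprMn !sqr_normcE -subr_ge0.
have -> : (complex.Re x ^+ 2 + complex.Im x ^+ 2) *
    (complex.Re y ^+ 2 + complex.Im y ^+ 2) - flux x y ^+ 2 =
    (complex.Re x * complex.Re y + complex.Im x * complex.Im y) ^+ 2.
  by rewrite /flux; ring.
exact: sqr_ge0.
Qed.

End ComplexModulus.

(** * Canonical form of the recurrence *)

Section CanonicalSystem.
Local Open Scope complex_scope.
Variable R : realType.
Variables p q : nat -> R.

(** The three-term recurrence at [z], written relative to the two real solutions
[p] and [q] at [0]: [X] and [Y] are the Wronskians of [u] with [p] and [q], and
they change only by multiples of [u n]. In these coordinates one step of the
recurrence is the matrix [1 + z * N] with [N] nilpotent of rank one. *)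
Definition canonical_sol (z : R[i]) (u X Y : nat -> R[i]) := forall n,
  [/\ X n.+1 = X n + z * ((p n)%:C * u n),
      Y n.+1 = Y n + z * ((q n)%:C * u n)
    & u n = (q n)%:C * X n - (p n)%:C * Y n].

(** Bound for the nilpotent matrix of the [n]-th step; it is comparable to
[p n ^+ 2 + q n ^+ 2]. *)
Definition jump n : R := (`|p n| + `|q n|) ^+ 2.

Lemma jump_ge0 n : 0 <= jump n.
Proof. exact: sqr_ge0. Qed.

Lemma p_le_jump n : p n ^+ 2 <= jump n.
Proof. by rewrite -real_normK ?num_real// lerXn2r ?nnegrE ?addr_ge0// lerDl. Qed.

Lemma q_le_jump n : q n ^+ 2 <= jump n.
Proof. by rewrite -real_normK ?num_real// lerXn2r ?nnegrE ?addr_ge0// lerDr. Qed.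

Variables (z : R[i]) (u X Y : nat -> R[i]).
Hypothesis can : canonical_sol z u X Y.

Lemma canonical_sol_step n :
  normc (u n) <= (`|p n| + `|q n|) * (normc (X n) + normc (Y n)).
Proof.
have [_ _ ->] := can n.
rewrite (le_trans (normcB _ _))// !normcM !normc_real mulrDl [leLHS]addrC.
rewrite lerD// ler_wpM2l ?normr_ge0// ?lerDl ?lerDr normc_ge0//.
Qed.

Lemma canonical_sol_jump n : normc ((p n)%:C * u n) + normc ((q n)%:C * u n)
  <= jump n * (normc (X n) + normc (Y n)).
Proof.
rewrite !normcM !normc_real -mulrDl /jump expr2 -mulrA ler_wpM2l ?addr_ge0//.
exact: canonical_sol_step.
Qed.

Lemma canonical_sol_ub n : normc (X n) + normc (Y n) <=
  (normc (X 0) + normc (Y 0)) * \prod_(j < n) (1 + normc z * jump j).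
Proof.
elim: n => [|n IHn]; first by rewrite big_ord0 mulr1.
rewrite big_ord_recr/= mulrA; set P := (X in _ <= X * _).
have [-> -> _] := can n.
have c0 : 0 <= 1 + normc z * jump n.
  by rewrite addr_ge0// mulr_ge0 ?normc_ge0 ?jump_ge0.
apply: (@le_trans _ _ ((normc (X n) + normc (Y n)) * (1 + normc z * jump n)));
  last by rewrite ler_wpM2r.
have := normcD (X n) (z * ((p n)%:C * u n)).
have := normcD (Y n) (z * ((q n)%:C * u n)).
rewrite !(normcM z).
have := ler_wpM2l (normc_ge0 z) (canonical_sol_jump n).
lra.
Qed.

(** Energy identity: only the imaginary part of [z] makes the flux change. *)
Lemma flux_step n :
  flux (X n.+1) (Y n.+1) = flux (X n) (Y n) + complex.Im z * normc (u n) ^+ 2.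
Proof.
have [-> -> ->] := can n; rewrite sqr_normcE /flux.
case: z => zr zi; case: (X n) => xr xi; case: (Y n) => yr yi /=.
ring.
Qed.

Lemma flux_sum n : flux (X 0) (Y 0) = 0 ->
  flux (X n) (Y n) = complex.Im z * \sum_(j < n) normc (u j) ^+ 2.
Proof.
move=> F0; elim: n => [|n IHn]; first by rewrite F0 big_ord0 mulr0.
by rewrite flux_step IHn big_ord_recr/= mulrDr.
Qed.

(** The flux is also the Wronskian-type expression of two consecutive values of
[u]; this is where the off-diagonal coefficient [beta] enters. *)
Lemma flux_wronskian n (beta : R) :
  beta * (p n * q n.+1 - p n.+1 * q n) = 1 ->
  flux (X n.+1) (Y n.+1) = beta * flux (u n) (u n.+1).
Proof.
move=> w; have [_ _ uS] := can n.+1.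
(* The increments of [X] and [Y] at step [n] cancel in [u n]. *)
have un : u n = (q n)%:C * X n.+1 - (p n)%:C * Y n.+1.
  have [-> -> e] := can n; rewrite [LHS]e; ring.
have -> : flux (u n) (u n.+1) =
   (p n * q n.+1 - p n.+1 * q n) * flux (X n.+1) (Y n.+1).
  rewrite uS un /flux.
  case: (X n.+1) => xr xi; case: (Y n.+1) => yr yi /=.
  ring.
by rewrite mulrA w mul1r.
Qed.

End CanonicalSystem.
(** * Lower bound on the imaginary axis *)

Section LowerBound.
Local Open Scope complex_scope.
Variable R : realType.

Lemma cauchy_schwarz_ord (s t : nat -> R) n :
  (\sum_(j < n) s j * t j) ^+ 2 <=
  (\sum_(j < n) s j ^+ 2) * (\sum_(j < n) t j ^+ 2).
Proof.
elim: n => [|n IHn]; first by rewrite !big_ord0 expr0n/= mulr0.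
rewrite !big_ord_recr/=.
have : 0 <= \sum_(j < n) s j ^+ 2 by apply: sumr_ge0 => *; exact: sqr_ge0.
have : 0 <= \sum_(j < n) t j ^+ 2 by apply: sumr_ge0 => *; exact: sqr_ge0.
move: IHn; move: (\sum_(j < n) s j * t j) (\sum_(j < n) s j ^+ 2)
  (\sum_(j < n) t j ^+ 2) (s n) (t n) => S P Q x y SPQ Q0 P0.
have h : `|2 * (S * (x * y))| <= P * y ^+ 2 + Q * x ^+ 2.
  apply: ler_norm_sqr; first by rewrite addr_ge0// mulr_ge0// sqr_ge0.
  apply: (@le_trans _ _ (4 * (P * Q) * (x * y) ^+ 2)).
    have -> : (2 * (S * (x * y))) ^+ 2 = 4 * (S ^+ 2 * (x * y) ^+ 2) by ring.
    by rewrite -mulrA ler_pM2l// ler_wpM2r// sqr_ge0.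
  rewrite -subr_ge0.
  have -> : (P * y ^+ 2 + Q * x ^+ 2) ^+ 2 - 4 * (P * Q) * (x * y) ^+ 2
    = (P * y ^+ 2 - Q * x ^+ 2) ^+ 2 by ring.
  exact: sqr_ge0.
have := le_trans (ler_norm _) h.
rewrite -subr_ge0 => h2; rewrite -subr_ge0.
have -> : (P + x ^+ 2) * (Q + y ^+ 2) - (S + x * y) ^+ 2 =
  (P * Q - S ^+ 2) + (P * y ^+ 2 + Q * x ^+ 2 - 2 * (S * (x * y))) by ring.
by rewrite addr_ge0// subr_ge0.
Qed.

(** As [x] exceeds [1] by at most a multiple of [sqrt (x * y)], either [x <= 2] or
[x] is at most [4 * K * y]; in both cases a large product makes [y] large. *)
Lemma le_of_product_bounds (x y s F K : R) : 0 <= x -> 0 <= y -> 0 <= s ->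
  1 <= F -> 1 <= K -> F <= x * y -> x <= 1 + s -> s ^+ 2 <= K * (x * y) ->
  F <= 4 * K * y ^+ 2.
Proof.
move=> x0 y0 s0 F1 K1 Fxy xs sK.
have K0 : 0 <= K by lra.
have [x2|x2] := lerP x 2.
  have y1 : F <= 2 * y by apply: le_trans Fxy _; rewrite ler_wpM2r.
  apply: (@le_trans _ _ (F * F)); first by rewrite ler_peMl//; lra.
  apply: (@le_trans _ _ ((2 * y) * (2 * y))); first by rewrite ler_pM//; lra.
  have -> : 4 * K * y ^+ 2 = K * (2 * y * (2 * y)) by ring.
  by rewrite ler_peMl// !mulr_ge0.
have xKy : x <= 4 * K * y.
  have xx : x * x <= x * (4 * K * y).
    apply: (@le_trans _ _ ((2 * s) * (2 * s))); first by rewrite ler_pM//; lra.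
    have -> : 2 * s * (2 * s) = 4 * s ^+ 2 by ring.
    have -> : x * (4 * K * y) = 4 * (K * (x * y)) by ring.
    by rewrite ler_pM2l.
  by rewrite -(ler_pM2l (_ : 0 < x))//; lra.
apply: le_trans Fxy _; rewrite expr2 mulrA ler_wpM2r//.
Qed.

(* From here on [z = 'i * r], so the flux [F] is nondecreasing. The condition
   [F0] holds for real initial values, and [u01], [rc] make [F 2] at least 1. *)
Variables p q b : nat -> R.
Hypothesis b_gt0 : forall n, 0 < b n.
Hypothesis wronskian : forall n, b n * (p n * q n.+1 - p n.+1 * q n) = 1.
Variables (H : R).
Hypothesis H1 : 1 <= H.
Hypothesis jump_sum : forall n, \sum_(j < n) jump p q j <= H.

Variables (r c : R) (u X Y : nat -> R[i]).
Hypothesis r1 : 1 <= r.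
Hypothesis can : canonical_sol p q (0 +i* r) u X Y.
Hypothesis F0 : flux (X 0) (Y 0) = 0.
Hypothesis X0 : normc (X 0) <= 1.
Hypothesis Y0 : normc (Y 0) <= 1.
Hypothesis c0 : 0 < c.
Hypothesis u01 : c <= normc (u 0) ^+ 2 + normc (u 1) ^+ 2.
Hypothesis rc : 1 <= r * c.

Let r_ge0 : 0 <= r := le_trans ler01 r1.

Let F n := flux (X n) (Y n).

Let FS n : F n.+1 = F n + r * normc (u n) ^+ 2.
Proof. exact: (flux_step can). Qed.

Let F2 : r * c <= F 2.
Proof. by rewrite !FS /F F0 add0r -mulrDr ler_wpM2l//; apply: le_trans r1. Qed.

(** By the arithmetic-geometric mean inequality, [F n.+1 = b n * flux (u n) (u n.+1)]
is at most [b n / 2] times [normc (u n) ^+ 2 + normc (u n.+1) ^+ 2], and the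
latter sum is [(F n.+2 - F n) / r]. *)
Lemma flux_recurrence n : F n + 2 * r / b n * F n.+1 <= F n.+2.
Proof.
have h : 2 * (b n)^-1 * F n.+1 <= normc (u n) ^+ 2 + normc (u n.+1) ^+ 2.
  rewrite /F (flux_wronskian can (wronskian n)) mulrA -[2 * _ * _]mulrA.
  rewrite mulVf ?gt_eqF// mulr1.
  have := le_trans (ler_norm _) (flux_le (u n) (u n.+1)).
  have := sqr_ge0 (normc (u n) - normc (u n.+1)); rewrite sqrrB mulr2n.
  lra.
have r0 : 0 <= r := le_trans ler01 r1.
have -> : 2 * r / b n * F n.+1 = r * (2 * (b n)^-1 * F n.+1) by ring.
have -> : F n.+2 = F n + r * (normc (u n) ^+ 2 + normc (u n.+1) ^+ 2).
  by rewrite !FS -addrA -mulrDr.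
rewrite lerD2l.
exact: ler_wpM2l.
Qed.

Let F_nd n : F n <= F n.+1.
Proof. by rewrite FS lerDl mulr_ge0 ?sqr_ge0. Qed.

Let F_ge n : r * c <= F n.+2.
Proof. by elim: n => // n IHn; rewrite (le_trans IHn)// F_nd. Qed.

(** The product of two consecutive fluxes gains a factor [1 + 2 * r / b n] at
every step, whether or not the sequence [b] is monotone. *)
Lemma flux_growth n :
  (r * c) ^+ 2 * \prod_(j < n) (1 + 2 * r / b j.+2) <= F n.+2 * F n.+3.
Proof.
have rc0 : 0 <= r * c := le_trans ler01 rc.
elim: n => [|n IHn]; first by rewrite big_ord0 mulr1 expr2 ler_pM.
have t0 : 0 <= 2 * r / b n.+2.
  by rewrite divr_ge0// ?mulr_ge0// ltW.
have d0 : 0 <= 1 + 2 * r / b n.+2 by rewrite addr_ge0.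
rewrite big_ord_recr/= mulrA (le_trans (ler_wpM2r d0 IHn))//.
have F2p : 0 <= F n.+3 by rewrite (le_trans rc0)// F_ge.
rewrite mulrAC [leRHS]mulrC ler_wpM2r//.
apply: le_trans (flux_recurrence n.+2).
by rewrite mulrDr mulr1 lerD2l mulrC ler_wpM2l// F_nd.
Qed.

Lemma partial_sum_X n : X n = X 0 + (0 +i* r) * \sum_(j < n) (p j)%:C * u j.
Proof.
elim: n => [|n IHn]; first by rewrite big_ord0 mulr0 addr0.
by have [-> _ _] := can n; rewrite IHn big_ord_recr/= mulrDr addrA.
Qed.

Lemma partial_sum_Y n : Y n = Y 0 + (0 +i* r) * \sum_(j < n) (q j)%:C * u j.
Proof.
elim: n => [|n IHn]; first by rewrite big_ord0 mulr0 addr0.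
by have [_ -> _] := can n; rewrite IHn big_ord_recr/= mulrDr addrA.
Qed.

Lemma sqr_increment_le (w : nat -> R) n :
    (forall j, w j ^+ 2 <= jump p q j) ->
  normc ((0 +i* r) * \sum_(j < n) (w j)%:C * u j) ^+ 2 <=
  (r * H) * (normc (X n) * normc (Y n)).
Proof.
move=> wj; rewrite normcM exprMn.
have -> : normc (0 +i* r) = r.
  by rewrite /normc/= expr0n/= add0r sqrtr_sqr ger0_norm.
have r0 : 0 <= r := le_trans ler01 r1.
apply: (@le_trans _ _ (r * H * F n)); last first.
  rewrite ler_wpM2l//; first by rewrite mulr_ge0// (le_trans ler01).
  exact: le_trans (ler_norm _) (flux_le _ _).
rewrite /F (flux_sum can n F0)/=.
have -> : r * H * (r * \sum_(j < n) normc (u j) ^+ 2) =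
  r ^+ 2 * (H * \sum_(j < n) normc (u j) ^+ 2) by ring.
rewrite ler_wpM2l ?sqr_ge0//.
apply: (@le_trans _ _ ((\sum_(j < n) `|w j| * normc (u j)) ^+ 2)).
  rewrite lerXn2r ?nnegrE ?normc_ge0 ?sumr_ge0//.
    by move=> j _; rewrite mulr_ge0 ?normc_ge0.
  rewrite (le_trans (normc_sum _ _))// ler_sum// => j _.
  by rewrite normcM normc_real.
rewrite (le_trans (cauchy_schwarz_ord (fun j => `|w j|) (fun j => normc (u j)) n))//=.
rewrite ler_wpM2r ?sumr_ge0// => [j _|]; first exact: sqr_ge0.
rewrite (le_trans _ (jump_sum n))// ler_sum// => j _.
by rewrite real_normK ?num_real.
Qed.

(** The flux is at most [normc (X n) * normc (Y n)], and it controls the increments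
of [X] and of [Y] by the Cauchy-Schwarz inequality; hence [X] and [Y] are both
large, not only their product. *)
Lemma canonical_sol_lb n :
  c ^+ 2 * \prod_(j < n) (1 + 2 * r / b j.+2) <= 16 * H ^+ 2 * normc (X n.+3) ^+ 4
  /\
  c ^+ 2 * \prod_(j < n) (1 + 2 * r / b j.+2) <= 16 * H ^+ 2 * normc (Y n.+3) ^+ 4.
Proof.
have r0 : 0 < r := lt_le_trans ltr01 r1.
have F1 : 1 <= F n.+3 by rewrite (le_trans rc)// (F_ge n.+1).
have K1 : 1 <= r * H by rewrite mulr_ege1.
have FXY : F n.+3 <= normc (X n.+3) * normc (Y n.+3).
  exact: le_trans (ler_norm _) (flux_le _ _).
have main (s : R) : 0 <= s -> F n.+3 <= 4 * (r * H) * s ^+ 2 ->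
    c ^+ 2 * \prod_(j < n) (1 + 2 * r / b j.+2) <= 16 * H ^+ 2 * s ^+ 4.
  move=> s0 Fs; rewrite -(ler_pM2l (_ : 0 < r ^+ 2)) ?exprn_gt0//.
  rewrite mulrA -exprMn (le_trans (flux_growth n))//.
  apply: (@le_trans _ _ (F n.+3 * F n.+3)).
    by rewrite ler_wpM2r ?F_nd// (le_trans ler01).
  have -> : r ^+ 2 * (16 * H ^+ 2 * s ^+ 4) =
    (4 * (r * H) * s ^+ 2) * (4 * (r * H) * s ^+ 2) by ring.
  by rewrite ler_pM// (le_trans ler01).
split; apply: main; rewrite ?normc_ge0//.
- apply: (@le_of_product_bounds (normc (Y n.+3)) _
    (normc ((0 +i* r) * \sum_(j < n.+3) (q j)%:C * u j))) => //;
    rewrite ?normc_ge0//.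
  + by rewrite mulrC.
  + rewrite partial_sum_Y (le_trans (normcD _ _))// lerD2r//.
  + rewrite [normc (Y _) * _]mulrC; apply: sqr_increment_le => j.
    exact: q_le_jump.
- apply: (@le_of_product_bounds (normc (X n.+3)) _
    (normc ((0 +i* r) * \sum_(j < n.+3) (p j)%:C * u j))) => //;
    rewrite ?normc_ge0//.
  + rewrite partial_sum_X (le_trans (normcD _ _))// lerD2r//.
  + by apply: sqr_increment_le => j; exact: p_le_jump.
Qed.

End LowerBound.
(** * Complex series *)

Section ComplexSeries.
Local Open Scope complex_scope.
Variable R : realType.
Implicit Types (u v : nat -> R[i]) (l z : R[i]).

(** Convergence of a complex sequence, with the real-valued modulus [normc]. *)
Definition ccvg (s : nat -> R[i]) l :=
  forall e : R, 0 < e -> \forall n \near \oo, normc (s n - l) <= e.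

Lemma csum_eq u l : ccvg (fun n => \sum_(j < n) u j) l -> csum u = l.
Proof.
move=> ul; rewrite /csum; apply: (@cvg_lim (R[i]^o)); first exact: norm_hausdorff.
apply/cvgrPdist_le => e e0.
have : (0 : R[i]) < (complex.Re e)%:C /\ e = (complex.Re e)%:C.
  by case: e e0 => x y; rewrite !ltcE/= => /andP[/eqP -> ->]; rewrite eqxx.
case; rewrite ltcR => {}e0 ->.
apply: filterS (ul _ e0) => n.
rewrite normc_dist /series/= big_mkord => h.
by rewrite -[leLHS]/((normc (l - \sum_(j < n) u j))%:C) lecR.
Qed.

Lemma bounded_series_cvg (f : nat -> R) (M : R) : (forall n, 0 <= f n) ->
  (forall n, \sum_(j < n) f j <= M) -> cvgn (series f).
Proof.
move=> f0 fM; apply: nondecreasing_is_cvgn.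
  by apply/nondecreasing_seqP => n; rewrite seriesSr lerDl.
by exists M => _ [n _ <-]; rewrite /series/= big_mkord.
Qed.

Lemma cvg_series_bounded (f : nat -> R) : (forall n, 0 <= f n) ->
  cvgn (series f) -> exists M : R, forall n, \sum_(j < n) f j <= M.
Proof.
move=> f0 cf; exists (limn (series f)) => n.
rewrite -(big_mkord xpredT f); apply: (@nondecreasing_cvgn_le _ (series f)) => //.
by apply/nondecreasing_seqP => k; rewrite seriesSr lerDl.
Qed.

Lemma dominated_series_cvg (f g : nat -> R) : (forall n, `|f n| <= g n) ->
  cvgn (series g) -> cvgn (series f).
Proof.
move=> fg cg; apply: normed_cvg.
apply: (series_le_cvg _ _ _ cg) => [n|n|]; [exact: normr_ge0|exact: le_trans (fg n)|exact: fg].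
Qed.

(** Absolute summability, as boundedness of the partial sums of the moduli. *)
Definition summable u := exists M : R, forall n, \sum_(j < n) normc (u j) <= M.

Lemma summable_ccvg u : summable u ->
  ccvg (fun n => \sum_(j < n) u j) (csum u).
Proof.
move=> [M uM].
have cu : cvgn (series (fun n => normc (u n))).
  by apply: bounded_series_cvg uM => n; exact: normc_ge0.
have cr : cvgn (series (fun n => complex.Re (u n))).
  by apply: dominated_series_cvg cu => n; exact: normc_Re.
have ci : cvgn (series (fun n => complex.Im (u n))).
  by apply: dominated_series_cvg cu => n; exact: normc_Im.
set x := limn (series (fun n => complex.Re (u n))).
set y := limn (series (fun n => complex.Im (u n))).
suff h : ccvg (fun n => \sum_(j < n) u j) (x +i* y) by rewrite (csum_eq h).
move=> e e0; have e20 : 0 < e / 2 by rewrite divr_gt0.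
move/cvgrPdist_le/(_ _ e20) : cr => cr; move/cvgrPdist_le/(_ _ e20) : ci => ci.
have sE n : \sum_(j < n) u j = (series (fun n => complex.Re (u n)) n) +i*
    (series (fun n => complex.Im (u n)) n).
  rewrite /series/= !big_mkord.
  elim: n => [|n IHn]; first by rewrite !big_ord0.
  by rewrite !big_ord_recr/= IHn; case: (u n).
near=> n.
rewrite sE normc_dist.
have -> : x +i* y - (series (fun n => complex.Re (u n)) n +i*
    series (fun n => complex.Im (u n)) n) =
  (x - series (fun n => complex.Re (u n)) n)%:C +
  'i * (y - series (fun n => complex.Im (u n)) n)%:C.
  by rewrite [RHS]/GRing.add/= ; simpc.
rewrite (le_trans (normcD _ _))// normcM !normc_real.
have -> : normc ('i : R[i]) = 1 by rewrite /normc/= expr0n/= add0r expr1n sqrtr1.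
rewrite mul1r [leRHS]splitr lerD//; near: n; [exact: cr|exact: ci].
Unshelve. all: by end_near.
Qed.

Lemma ccvg_affine (s : nat -> R[i]) l z w :
  ccvg s l -> ccvg (fun n => w + z * s n) (w + z * l).
Proof.
move=> sl e e0.
have z0 : 0 < normc z + 1 by rewrite ltr_wpDl// normc_ge0.
have := sl (e / (normc z + 1)) (divr_gt0 e0 z0).
apply: filterS => n h.
have -> : w + z * s n - (w + z * l) = z * (s n - l).
  by rewrite opprD addrACA subrr add0r mulrBr.
rewrite normcM; apply: (@le_trans _ _ ((normc z + 1) * (e / (normc z + 1)))).
  by rewrite ler_pM ?normc_ge0// lerDl.
by rewrite mulrCA divff ?mulr1// gt_eqF.
Qed.

Lemma ccvg_ub (s : nat -> R[i]) l (M : R) : ccvg s l ->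
  (\forall n \near \oo, normc (s n) <= M) -> normc l <= M.
Proof.
move=> sl sM; apply/ler_addgt0Pr => e e0.
have /filter_ex[] : \forall n \near \oo, normc l <= M + e.
  near=> n; have -> : l = s n - (s n - l) by rewrite subKr.
  rewrite (le_trans (normcB _ _))// lerD//; near: n; [exact: sM|exact: sl].
by [].
Unshelve. all: by end_near.
Qed.

Lemma ccvg_lb (s : nat -> R[i]) l (M : R) : ccvg s l ->
  (\forall n \near \oo, M <= normc (s n)) -> M <= normc l.
Proof.
move=> sl sM; apply/ler_addgt0Pr => e e0.
have /filter_ex[] : \forall n \near \oo, M <= normc l + e.
  near=> n; apply: (@le_trans _ _ (normc (s n))); first by near: n.
  have {1}-> : s n = l + (s n - l) by rewrite addrC subrK.
  rewrite (le_trans (normcD _ _))// lerD2l; near: n; exact: sl.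
by [].
Unshelve. all: by end_near.
Qed.

Lemma csumD u v : summable u -> summable v ->
  csum (fun n => u n + v n) = csum u + csum v.
Proof.
move=> su sv; apply: csum_eq => e e0; have e20 : 0 < e / 2 by rewrite divr_gt0.
near=> n; rewrite big_split/= opprD addrACA (le_trans (normcD _ _))//.
rewrite [leRHS]splitr lerD//; near: n;
  [exact: (summable_ccvg su)|exact: (summable_ccvg sv)].
Unshelve. all: by end_near.
Qed.

Lemma csum_conj u : summable u -> csum (fun n => (u n)^*) = (csum u)^*.
Proof.
move=> su; apply: csum_eq => e e0.
apply: filterS (summable_ccvg su e0) => n.
have -> : \sum_(j < n) (u j)^* - (csum u)^* = (\sum_(j < n) u j - csum u)^*.
  by rewrite rmorphB rmorph_sum.
by rewrite normc_conj.
Qed.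

Lemma csum_finsupp u N : (forall n, (N <= n)%N -> u n = 0) ->
  csum u = \sum_(j < N) u j.
Proof.
move=> uN; apply: csum_eq => e e0; near=> n.
have Nn : (N <= n)%N by near: n; exact: nbhs_infty_ge.
rewrite -!(big_mkord xpredT u) (big_cat_nat (leq0n N) Nn)/= addrAC subrr add0r.
rewrite big_nat_cond big1 ?normc0 ?ltW// => i /andP[/andP[Ni _] _].
exact: uN.
Unshelve. all: by end_near.
Qed.

End ComplexSeries.
(** * Orthogonal polynomials as canonical solutions *)

Section Orthopolynomials.
Local Open Scope complex_scope.
Variable R : realType.
Variables a b : nat -> R.
Hypothesis b_gt0 : forall n, 0 < b n.

(** The values at [0] of the orthogonal polynomials of the first and second kind,
as real sequences; see [p0E] and [q0E]. *)
Definition p0 n : R := complex.Re (orthopoly1 a b n 0).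
Definition q0 n : R := complex.Re (orthopoly2 a b n 0).

Lemma solution_from_real (c0 c1 : R) n :
  solution_from a b 0 c0%:C c1%:C n =
  (complex.Re (solution_from a b 0 c0%:C c1%:C n))%:C.
Proof.
rewrite /solution_from.
suff [v [w ->]] : exists v w,
  solution_pair a b 0 c0%:C c1%:C n = (v%:C, w%:C) by [].
elim: n => [|n [v [w IHn]]]; first by exists c0, c1.
exists w, (((0 - a n.+1) * w - b n * v) / b n.+1); rewrite /= IHn.
by rewrite !rmorphM/= rmorphB/= !rmorphM/= rmorphB/= rmorph0 fmorphV.
Qed.

Lemma p0E n : orthopoly1 a b n 0 = (p0 n)%:C.
Proof.
rewrite /p0 /orthopoly1.
have -> : (0 - (a 0)%:C) / (b 0)%:C = ((0 - a 0) / b 0)%:C :> R[i].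
  by rewrite rmorphM/= rmorphB/= rmorph0 fmorphV.
exact: solution_from_real.
Qed.

Lemma q0E n : orthopoly2 a b n 0 = (q0 n)%:C.
Proof.
rewrite /q0 /orthopoly2.
have -> : (b 0)%:C^-1 = ((b 0)^-1)%:C :> R[i] by rewrite fmorphV.
exact: (solution_from_real 0).
Qed.

Let bC n : (b n)%:C != 0 :> R[i].
Proof. by rewrite fmorph_eq0 gt_eqF. Qed.

Lemma p_recurrence z : recurrence_solution a b z (orthopoly1 a b ^~ z).
Proof. by have [_ _] := solution_fromP a z 1 ((z - (a 0)%:C) / (b 0)%:C) b_gt0. Qed.

Lemma q_recurrence z : recurrence_solution a b z (orthopoly2 a b ^~ z).
Proof. by have [_ _] := solution_fromP a z 0 ((b 0)%:C^-1) b_gt0. Qed.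

Let p0_0 : p0 0 = 1. Proof. by []. Qed.
Let q0_0 : q0 0 = 0. Proof. by []. Qed.
Let p0_1 : b 0 * p0 1 = - a 0.
Proof.
apply: complexI; rewrite rmorphM/= -p0E /orthopoly1 /solution_from/=.
by rewrite mulrC divfK// sub0r rmorphN.
Qed.
Let q0_1 : b 0 * q0 1 = 1.
Proof.
apply: complexI; rewrite rmorphM/= -q0E /orthopoly2 /solution_from/=.
by rewrite divff// rmorph1.
Qed.

Let rec0 (s : nat -> R) : recurrence_solution a b 0 (fun n => (s n)%:C) ->
  forall n, b n.+1 * s n.+2 = - a n.+1 * s n.+1 - b n * s n.
Proof.
move=> h n; have /= := h n.+1 isT; rewrite mul0r -!rmorphM -!rmorphD/=.
move/(@complexI R _ 0) => e.
by apply/eqP; rewrite -subr_eq0 -e; apply/eqP; ring.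
Qed.

Lemma p0_rec n : b n.+1 * p0 n.+2 = - a n.+1 * p0 n.+1 - b n * p0 n.
Proof.
apply: rec0 => {}n n1; rewrite -!p0E; exact: p_recurrence.
Qed.

Lemma q0_rec n : b n.+1 * q0 n.+2 = - a n.+1 * q0 n.+1 - b n * q0 n.
Proof.
apply: rec0 => {}n n1; rewrite -!q0E; exact: q_recurrence.
Qed.

Lemma wronskian0 n : b n * (p0 n * q0 n.+1 - p0 n.+1 * q0 n) = 1.
Proof.
elim: n => [|n IHn]; first by rewrite p0_0 q0_0 mulr0 subr0 mul1r.
rewrite -[RHS]IHn.
have -> : b n.+1 * (p0 n.+1 * q0 n.+2 - p0 n.+2 * q0 n.+1) =
  p0 n.+1 * (b n.+1 * q0 n.+2) - (b n.+1 * p0 n.+2) * q0 n.+1 by ring.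
by rewrite p0_rec q0_rec; ring.
Qed.

Section CanonicalForm.
Variables (z x0 y0 : R[i]) (u : nat -> R[i]).
Hypothesis u_rec : recurrence_solution a b z u.
Hypothesis u_0 : u 0 = - y0.
Hypothesis u_1 : (b 0)%:C * u 1 + (a 0)%:C * u 0 = x0 + z * u 0.

(** Partial sums which converge to entries of the Nevanlinna matrix. For the
polynomials of the first kind, [x0 = 0] and [y0 = -1] give [D] and [B]; for those
of the second kind, [x0 = 1] and [y0 = 0] give [C] and [A]. *)
Definition canonX n := x0 + z * \sum_(j < n) (p0 j)%:C * u j.
Definition canonY n := y0 + z * \sum_(j < n) (q0 j)%:C * u j.

Let rec n : (b n.+1)%:C * u n.+2 =
  z * u n.+1 - (a n.+1)%:C * u n.+1 - (b n)%:C * u n.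
Proof. by have /= <- := u_rec (ltn0Sn n); ring. Qed.

Lemma canonX_wronskian n : canonX n.+1 =
  (b n)%:C * (u n.+1 * (p0 n)%:C - u n * (p0 n.+1)%:C).
Proof.
elim: n => [|n IHn].
  have -> : (b 0)%:C * (u 1 * (p0 0)%:C - u 0 * (p0 1)%:C) =
    (b 0)%:C * u 1 * (p0 0)%:C - u 0 * ((b 0) * (p0 1))%:C by rewrite rmorphM/=; ring.
  rewrite p0_1 /canonX big_ord_recr big_ord0/= p0_0 add0r rmorphN rmorph1 !mul1r mulr1.
  rewrite -[_ * u 1](addrK ((a 0)%:C * u 0)) u_1; ring.
rewrite /canonX big_ord_recr/= mulrDr addrA -/(canonX n.+1) IHn.
have -> : (b n.+1)%:C * (u n.+2 * (p0 n.+1)%:C - u n.+1 * (p0 n.+2)%:C) =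
  ((b n.+1)%:C * u n.+2) * (p0 n.+1)%:C - u n.+1 * (b n.+1 * p0 n.+2)%:C.
  by rewrite rmorphM/=; ring.
by rewrite rec p0_rec rmorphB !rmorphM rmorphN /=; ring.
Qed.

Lemma canonY_wronskian n : canonY n.+1 =
  (b n)%:C * (u n.+1 * (q0 n)%:C - u n * (q0 n.+1)%:C).
Proof.
elim: n => [|n IHn].
  have e : (b 0)%:C * (q0 1)%:C = 1 by rewrite -rmorphM/= q0_1 rmorph1.
  have -> : (b 0)%:C * (u 1 * (q0 0)%:C - u 0 * (q0 1)%:C) =
    (b 0)%:C * u 1 * (q0 0)%:C - u 0 * ((b 0)%:C * (q0 1)%:C) by ring.
  have -> : canonY 1 = y0 by rewrite /canonY big_ord1 q0_0 rmorph0 mul0r mulr0 addr0.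
  by rewrite e q0_0 rmorph0 u_0; ring.
rewrite /canonY big_ord_recr/= mulrDr addrA -/(canonY n.+1) IHn.
have -> : (b n.+1)%:C * (u n.+2 * (q0 n.+1)%:C - u n.+1 * (q0 n.+2)%:C) =
  ((b n.+1)%:C * u n.+2) * (q0 n.+1)%:C - u n.+1 * (b n.+1 * q0 n.+2)%:C.
  by rewrite rmorphM/=; ring.
by rewrite rec q0_rec rmorphB !rmorphM rmorphN /=; ring.
Qed.

Lemma canonical_form : canonical_sol p0 q0 z u canonX canonY.
Proof.
move=> n; split.
- by rewrite /canonX big_ord_recr/= mulrDr addrA.
- by rewrite /canonY big_ord_recr/= mulrDr addrA.
case: n => [|n].
  by rewrite u_0 /canonX /canonY p0_0 q0_0 !big_ord0 rmorph0 rmorph1; ring.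
rewrite canonX_wronskian canonY_wronskian.
transitivity ((b n * (p0 n * q0 n.+1 - p0 n.+1 * q0 n))%:C * u n.+1).
  by rewrite wronskian0 rmorph1 mul1r.
by rewrite rmorphM rmorphB !rmorphM/=; ring.
Qed.

End CanonicalForm.

Lemma orthopoly1_canonical z : canonical_sol p0 q0 z (orthopoly1 a b ^~ z)
  (canonX z 0 (orthopoly1 a b ^~ z)) (canonY z (-1) (orthopoly1 a b ^~ z)).
Proof.
apply: canonical_form; [exact: p_recurrence| |].
  by rewrite opprK.
by rewrite /orthopoly1 /solution_from/= mulrCA divff// !mulr1 subrK add0r.
Qed.

Lemma orthopoly2_canonical z : canonical_sol p0 q0 z (orthopoly2 a b ^~ z)
  (canonX z 1 (orthopoly2 a b ^~ z)) (canonY z 0 (orthopoly2 a b ^~ z)).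
Proof.
apply: canonical_form; [exact: q_recurrence| |].
  by rewrite oppr0.
by rewrite /orthopoly2 /solution_from/= divff// !mulr0 !addr0.
Qed.

End Orthopolynomials.
(** * Size of the solutions at zero *)

Section JumpBound.
Local Open Scope complex_scope.
Variable R : realType.
Variables (a b : nat -> R) (k : int).
Hypothesis b_gt0 : forall n, 0 < b n.
Hypothesis sol_bound : forall u : nat -> R[i], recurrence_solution a b 0 u ->
     (fun n => normc (u n)) =O_\oo
       (fun n => b (absz (n%:Z + k)) `^ (- 2^-1)).

Lemma sol_bound_norm (u : nat -> R[i]) : recurrence_solution a b 0 u ->
  exists K : R, 0 < K /\ \forall n \near \oo,
    normc (u n) <= K * b (absz (n%:Z + k)) `^ (- 2^-1).
Proof.
move=> /sol_bound/eqO_exP[K K0 h]; exists K; split=> //.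
apply: filterS h => n /=; rewrite ger0_norm ?normc_ge0// ger0_norm//.
exact: powR_ge0.
Qed.

Lemma jump_le : exists K : R, 0 < K /\ \forall n \near \oo,
  jump (p0 a b) (q0 a b) n <= K * (b (absz (n%:Z + k)))^-1.
Proof.
have [K [K0 pK]] := sol_bound_norm (p_recurrence a b_gt0 0).
have [L [L0 qL]] := sol_bound_norm (q_recurrence a b_gt0 0).
exists ((K + L) ^+ 2); split; first by rewrite exprn_gt0// addr_gt0.
apply: filterS2 pK qL => n pn qn; set bn := b _ in pn qn *.
have -> : bn^-1 = (bn `^ (- 2^-1)) ^+ 2.
  rewrite -powR_mulrn ?powR_ge0// -powRrM mulNr mulVf// powR_inv1//.
  exact: ltW (b_gt0 _).
rewrite /jump -exprMn lerXn2r ?nnegrE ?addr_ge0 ?mulr_ge0 ?powR_ge0//.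
  by rewrite addr_ge0// ltW.
rewrite mulrDl lerD//.
  by rewrite -normc_real -p0E.
by rewrite -normc_real -q0E.
Qed.

(** Away from the finitely many indices with [j + k < 0], the shift by [k] is
injective. *)
Lemma shifted_sum_le (f : nat -> R) (N n : nat) : (forall j, 0 <= f j) ->
  (absz k <= N)%N ->
  \sum_(N <= j < n) f (absz (j%:Z + k)) <= \sum_(0 <= j < n + absz k) f j.
Proof.
move=> f0 kN.
have inj : {in index_iota N n &, injective (fun j : nat => absz (j%:Z + k))}.
  by move=> i j; rewrite !mem_index_iota => /andP[Ni _] /andP[Nj _] /=; lia.
rewrite -(big_map (fun j : nat => absz (j%:Z + k)) xpredT f).
rewrite [leRHS](bigID (fun j => j \in [seq absz (j%:Z + k) | j <- index_iota N n]))/=.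
rewrite -[leLHS]addr0 lerD ?sumr_ge0//.
rewrite -[leRHS]big_filter le_eqVlt; apply/orP; left; apply/eqP/perm_big.
apply: uniq_perm.
- by rewrite map_inj_in_uniq ?iota_uniq.
- by rewrite filter_uniq ?iota_uniq.
move=> i; rewrite mem_filter mem_index_iota leq0n/= andb_idr//.
by move=> /mapP[j]; rewrite mem_index_iota => /andP[Nj jn] ->; lia.
Qed.

(** Summability of a power of [1 / b] carries over to the jumps, by the bound on
the solutions at [0]. *)
Lemma jump_powR_sum (al : R) : 0 < al -> cvgn (series (fun n => b n `^ (- al))) ->
  exists M : R, forall n, \sum_(j < n) jump (p0 a b) (q0 a b) j `^ al <= M.
Proof.
move=> al0 /(cvg_series_bounded (fun n => powR_ge0 _ _))[M bM].
have [K [K0 [N0 _ jK]]] := jump_le.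
pose N := maxn N0 (absz k).
pose J n := jump (p0 a b) (q0 a b) n `^ al.
exists (\sum_(0 <= j < N) J j + K `^ al * M) => n.
have J0 j : 0 <= J j by exact: powR_ge0.
have M0 : 0 <= M by have := bM 0; rewrite big_ord0.
rewrite -(big_mkord xpredT J); have [nN|Nn] := leqP n N.
  rewrite -[leLHS]addr0 lerD ?mulr_ge0 ?powR_ge0//.
  by rewrite (big_cat_nat (leq0n n) nN)/= lerDl sumr_ge0.
rewrite (big_cat_nat (leq0n N) (ltnW Nn))/= lerD2l.
apply: (@le_trans _ _ (\sum_(N <= j < n) K `^ al * b (absz (j%:Z + k)) `^ (- al))).
  rewrite ler_sum_nat// => j /andP[Nj _].
  have h := jK j (leq_trans (leq_maxl _ _) Nj).
  set bj := b _ in h *; have bj0 : 0 <= bj by exact/ltW/b_gt0.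
  have -> : bj `^ (- al) = bj^-1 `^ al.
    by rewrite -[bj^-1]powR_inv1// -powRrM mulN1r.
  rewrite -powRM ?invr_ge0//; last exact: ltW.
  apply: ge0_ler_powR => //; first exact: ltW.
  - by rewrite nnegrE jump_ge0.
  - by rewrite nnegrE mulr_ge0 ?invr_ge0// ltW.
rewrite -mulr_sumr ler_wpM2l ?powR_ge0//.
rewrite (le_trans (shifted_sum_le n (fun j => powR_ge0 (b j) (- al)) (leq_maxr _ _)))//.
by rewrite big_mkord.
Qed.

End JumpBound.
(** * Square summable sequences *)

Section Ell2.
Local Open Scope complex_scope.
Variable R : realType.
Implicit Types (x y v w : nat -> R[i]) (M e : R).

Lemma sqnorm_leP x M : (sqnorm x <= M%:E)%E <->
  forall n, \sum_(j < n) normc (x j) ^+ 2 <= M.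
Proof.
have x0 n : (0 <= (normc (x n) ^+ 2)%:E)%E by rewrite lee_fin sqr_ge0.
split=> [xM n|xM].
  rewrite -lee_fin -sumEFin (le_trans _ xM)//.
  rewrite -(big_mkord xpredT (fun j => (normc (x j) ^+ 2)%:E)).
  exact: nneseries_lim_ge.
apply: lime_le; first exact: is_cvg_nneseries.
by apply: nearW => n; rewrite big_mkord sumEFin lee_fin.
Qed.

Lemma ell2P x : ell2 x <-> exists M, forall n, \sum_(j < n) normc (x j) ^+ 2 <= M.
Proof.
rewrite /ell2/=; split=> [xoo|[M /sqnorm_leP xM]]; last first.
  exact: le_lt_trans xM (ltry _).
exists (fine (sqnorm x)); apply/sqnorm_leP; rewrite fineK//.
rewrite ge0_fin_numE//; apply: nneseries_ge0 => n _ _.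
by rewrite lee_fin sqr_ge0.
Qed.

Lemma finsupp_ell2 x : finitely_supported x -> ell2 x.
Proof.
move=> [N xN]; apply/ell2P; exists (\sum_(j < N) normc (x j) ^+ 2) => n.
rewrite -!(big_mkord xpredT (fun j => normc (x j) ^+ 2)).
have x0 j : 0 <= normc (x j) ^+ 2 by exact: sqr_ge0.
have [nN|Nn] := leqP n N.
  by rewrite (big_cat_nat (leq0n n) nN)/= lerDl sumr_ge0.
rewrite (big_cat_nat (leq0n N) (ltnW Nn))/= gerDl big_nat_cond big1//.
by move=> i /andP[/andP[Ni _] _]; rewrite xN// normc0 expr0n.
Qed.

(** The weighted arithmetic-geometric mean inequality, with a free parameter [t],
plays the role of the Cauchy-Schwarz inequality. *)
Lemma inner_partial_le x v M N t n : 0 < t ->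
  (forall n, \sum_(j < n) normc (x j) ^+ 2 <= M) ->
  (forall n, \sum_(j < n) normc (v j) ^+ 2 <= N) ->
  \sum_(j < n) normc (x j * (v j)^*) <= (t^-1 * M + t * N) / 2.
Proof.
move=> t0 xM vN.
apply: (@le_trans _ _ ((t^-1 * \sum_(j < n) normc (x j) ^+ 2 +
   t * \sum_(j < n) normc (v j) ^+ 2) / 2)).
  rewrite !mulr_sumr -big_split/= mulr_suml ler_sum// => j _.
  rewrite normcM normc_conj; set A := normc (x j); set B := normc (v j).
  rewrite ler_pdivlMr// -subr_ge0.
  have -> : t^-1 * A ^+ 2 + t * B ^+ 2 - A * B * 2 = t^-1 * (A - t * B) ^+ 2.
    by field; rewrite gt_eqF.
  by rewrite mulr_ge0 ?sqr_ge0// invr_ge0 ltW.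
rewrite ler_wpM2r ?invr_ge0// lerD// ler_wpM2l ?invr_ge0// ltW//.
Qed.

Lemma inner_summable x v : ell2 x -> ell2 v ->
  summable (fun n => x n * (v n)^*).
Proof.
move=> /ell2P[M xM] /ell2P[N vN]; exists ((1^-1 * M + 1 * N) / 2) => n.
exact: inner_partial_le.
Qed.

Lemma inner_le x v M N t : 0 < t ->
  (forall n, \sum_(j < n) normc (x j) ^+ 2 <= M) ->
  (forall n, \sum_(j < n) normc (v j) ^+ 2 <= N) ->
  normc (inner x v) <= (t^-1 * M + t * N) / 2.
Proof.
move=> t0 xM vN.
have sxv : summable (fun n => x n * (v n)^*).
  by apply: inner_summable; apply/ell2P; [exists M|exists N].
apply: (ccvg_ub (summable_ccvg sxv)); apply: nearW => n.
by rewrite (le_trans (normc_sum _ _))// inner_partial_le.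
Qed.

Lemma inner_conj x v : ell2 x -> ell2 v -> inner v x = (inner x v)^*.
Proof.
move=> hx hv; rewrite /inner -csum_conj; last exact: inner_summable.
by congr csum; apply/funext => n; rewrite rmorphM/= conjcK mulrC.
Qed.

Lemma ell2B x y : ell2 x -> ell2 y -> ell2 (x \- y).
Proof.
move=> /ell2P[M xM] /ell2P[N yN]; apply/ell2P; exists (2 * M + 2 * N) => n.
apply: (@le_trans _ _ (\sum_(j < n) (2 * normc (x j) ^+ 2 + 2 * normc (y j) ^+ 2))).
  rewrite ler_sum// => j _.
  apply: (@le_trans _ _ ((normc (x j) + normc (y j)) ^+ 2)).
    by rewrite lerXn2r ?nnegrE ?addr_ge0 ?normc_ge0// normcB.
  have := sqr_ge0 (normc (x j) - normc (y j)); rewrite sqrrB sqrrD !mulr2n.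
  lra.
rewrite big_split/= -!mulr_sumr; apply: lerD; [exact: (ler_wpM2l _ (xM n))|exact: (ler_wpM2l _ (yN n))].
Qed.

Lemma innerBl x y v : ell2 x -> ell2 y -> ell2 v ->
  inner (x \- y) v = inner x v - inner y v.
Proof.
move=> hx hy hv; apply/eqP; rewrite eq_sym subr_eq; apply/eqP.
rewrite /inner -csumD; first last.
- exact: inner_summable.
- by apply: inner_summable => //; exact: ell2B.
by congr csum; apply/funext => n /=; rewrite -mulrDl subrK.
Qed.

(** Continuity of the inner product: an identity between inner products which
holds on a graph also holds on its closure. *)
Lemma closure_inner (T : graph R) v w : ell2 v -> ell2 w ->
  (forall p, T p -> ell2 p.1 /\ ell2 p.2) ->
  (forall p, T p -> inner p.2 v = inner p.1 w) ->
  forall p, graph_closure T p -> inner p.2 v = inner p.1 w.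
Proof.
move=> hv hw T2 Tvw p [hp1 hp2 pT].
apply/eqP; rewrite -subr_eq0; apply/eqP/eq0_normc/eqP.
rewrite eq_le normc_ge0 andbT; apply/ler_addgt0Pr => e e0; rewrite add0r.
have /ell2P[M vM] := hv; have /ell2P[N wN] := hw.
have M0 : 0 <= M by have := vM 0; rewrite big_ord0.
have N0 : 0 <= N by have := wN 0; rewrite big_ord0.
(* With squared distances below [t * t], both error terms are at most
   [t * (1 + M) / 2] and [t * (1 + N) / 2], of sum [e / 2]. *)
pose t := e / (2 + M + N).
have d0 : 0 < 2 + M + N by lra.
have t0 : 0 < t by rewrite divr_gt0.
have [q Tq [/ltW/sqnorm_leP q1 /ltW/sqnorm_leP q2]] := pT (t * t) (mulr_gt0 t0 t0).
have [hq1 hq2] := T2 q Tq.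
have -> : inner p.2 v - inner p.1 w = inner (p.2 \- q.2) v - inner (p.1 \- q.1) w.
  by rewrite !innerBl// (Tvw q Tq); ring.
rewrite (le_trans (normcB _ _))//.
have := inner_le t0 q2 vM; have := inner_le t0 q1 wN.
have -> : t^-1 * (t * t) = t by rewrite mulrA mulVf ?mul1r// gt_eqF.
have : t * (2 + M + N) = e by rewrite /t divfK// gt_eqF.
lra.
Qed.

Lemma finsupp_dense x e : ell2 x -> 0 < e -> exists2 y,
  finitely_supported y & (sqnorm (x \- y)%R < e%:E)%E.
Proof.
move=> /ell2P[M xM] e0.
have e20 : 0 < e / 2 by rewrite divr_gt0.
have x0 j : 0 <= normc (x j) ^+ 2 by exact: sqr_ge0.
pose S := series (fun j => normc (x j) ^+ 2).
have cS : cvgn S by exact: bounded_series_cvg xM.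
have /cvgrPdist_le/(_ _ e20)[N _ /(_ N (leqnn N)) SN] := cS.
(* Truncate [x] where the tail of its squared norm is at most [e / 2]. *)
exists (fun j => if (j < N)%N then x j else 0).
  by exists N => n; rewrite ltnNge => ->.
apply: (@le_lt_trans _ _ (e / 2)%:E); last by rewrite lte_fin ltr_pdivrMr//; lra.
apply/sqnorm_leP => n.
have S_le m : S m <= limn S.
  apply: nondecreasing_cvgn_le cS _.
  by apply/nondecreasing_seqP => k; rewrite /S seriesSr lerDl.
apply: (le_trans _ SN); apply: le_trans (ler_norm _).
rewrite lerBrDl (le_trans _ (S_le (maxn N n)))//.
rewrite /S /series/= (big_cat_nat (leq0n N) (leq_maxl N n))/= lerD2l.
rewrite -(big_mkord xpredT (fun j => normc (x j - (if (j < N)%N then x j else 0)) ^+ 2)).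
have [nN|Nn] := leqP n N.
  rewrite big_nat_cond big1 ?sumr_ge0// => i /andP[/andP[_ iN] _].
  by rewrite (leq_trans iN nN) subrr normc0 expr0n.
rewrite (big_cat_nat (leq0n N) (ltnW Nn))/=.
rewrite big_nat_cond big1 ?add0r; last first.
  by move=> i /andP[/andP[_ ->] _]; rewrite subrr normc0 expr0n.
by rewrite ler_sum_nat// => i /andP[Ni _]; rewrite ltnNge Ni subr0.
Qed.

End Ell2.
(** * Operators of the Jacobi matrix *)

Section LimitCircle.
Local Open Scope complex_scope.
Variable R : realType.
Variables (a b : nat -> R).
Hypothesis b_gt0 : forall n, 0 < b n.
Implicit Types (x v : nat -> R[i]).

Local Notation J := (jacobi_action a b).

Lemma jacobi_conj v n : (J v n)^* = J (fun m => (v m)^*) n.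
Proof.
apply/eqP; rewrite eq_complex /jacobi_action; case: n => [|n].
  by case: (v 0) => ? ?; case: (v 1) => ? ? /=; apply/andP; split; apply/eqP; ring.
case: (v n) => ? ?; case: (v n.+1) => ? ?; case: (v n.+2) => ? ? /=.
by apply/andP; split; apply/eqP; ring.
Qed.

Lemma green_formula x v n :
  \sum_(j < n.+1) (J x j * (v j)^*%C - x j * (J v j)^*%C) =
  (b n)%:C * (x n.+1 * (v n)^* - x n * (v n.+1)^*).
Proof.
under eq_bigr do rewrite jacobi_conj.
elim: n => [|n IHn]; first by rewrite big_ord1/= /jacobi_action; ring.
by rewrite big_ord_recr/= IHn /jacobi_action; ring.
Qed.

Lemma jacobi_finsupp x N : (forall n, (N <= n)%N -> x n = 0) ->
  forall n, (N < n)%N -> J x n = 0.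
Proof.
move=> xN [//|n]; rewrite ltnS => Nn.
by rewrite /jacobi_action !xN ?mulr0 ?addr0// (leq_trans Nn)// (leq_trans (leqnSn _)).
Qed.

Lemma inner_jacobi x v : finitely_supported x -> inner (J x) v = inner x (J v).
Proof.
move=> [N xN]; rewrite /inner (@csum_finsupp _ _ N.+1); last first.
  by move=> n Nn; rewrite (jacobi_finsupp xN)// mul0r.
rewrite [RHS](@csum_finsupp _ _ N.+1); last first.
  by move=> n Nn; rewrite xN ?mul0r// ltnW.
apply/eqP; rewrite -subr_eq0 -sumrB green_formula.
by rewrite !xN// !mul0r subrr mulr0.
Qed.

Let T0 : graph R := [set p | finitely_supported p.1 /\ p.2 = J p.1].

Let T0_ell2 p : T0 p -> ell2 p.1 /\ ell2 p.2.
Proof.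
move=> [[N xN] ->]; split; apply: finsupp_ell2; first by exists N.
by exists N.+1 => n; exact: jacobi_finsupp.
Qed.

Lemma finsupp_minimal_operator x : finitely_supported x ->
  minimal_operator a b (x, J x).
Proof.
move=> hx; have [x2 Jx2] : ell2 x /\ ell2 (J x) by exact: (@T0_ell2 (x, J x)).
split=> //= e e0; exists (x, J x) => //=.
have z0 (y : nat -> R[i]) : (sqnorm (y \- y)%R < e%:E)%E.
  apply: (@le_lt_trans _ _ 0%:E); last by rewrite lte_fin.
  apply/sqnorm_leP => n; rewrite big1// => j _.
  by rewrite /= subrr normc0 expr0n.
by split; exact: z0.
Qed.

Lemma minimal_operator_inner v w : ell2 v -> ell2 w ->
  (forall x, finitely_supported x -> inner (J x) v = inner x w) ->
  forall p, minimal_operator a b p -> inner p.2 v = inner p.1 w.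
Proof.
move=> v2 w2 vw; apply: closure_inner => // p [px ->]; exact: vw.
Qed.

Lemma minimal_operator_symmetric : symmetric_op (minimal_operator a b).
Proof.
split.
  move=> x x2 e e0; have [y hy xy] := finsupp_dense x2 e0.
  by exists (y, J y) => //; exact: finsupp_minimal_operator.
move=> p Tp; have [p1 p2 _] := Tp; split=> // q Tq.
move: q Tq; apply: minimal_operator_inner => // x hx.
have [x2 Jx2] : ell2 x /\ ell2 (J x) by exact: (@T0_ell2 (x, J x)).
rewrite inner_conj// [RHS]inner_conj//; congr (_^*)%C; apply/esym.
move: p Tp {p1 p2}; apply: minimal_operator_inner => // y hy.
exact: inner_jacobi.
Qed.

Lemma adjoint_jacobi v : ell2 v -> ell2 (J v) ->
  adjoint (minimal_operator a b) (v, J v).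
Proof.
move=> v2 w2; split=> //=; apply: minimal_operator_inner => // x hx.
exact: inner_jacobi.
Qed.

(** Testing against the unit sequences: the adjoint acts as the Jacobi matrix. *)
Lemma adjoint_minimal_operatorE v w : adjoint (minimal_operator a b) (v, w) -> w = J v.
Proof.
move=> [/= v2 w2 vw]; apply/funext => m.
pose e (n : nat) : R[i] := (n == m)%:R.
have e_m n : (m < n)%N -> e n = 0 by rewrite /e => /gtn_eqF ->.
have ee (y : nat -> R[i]) : inner e y = (y m)^*.
  rewrite /inner (@csum_finsupp _ _ m.+1) => [|n mn]; last by rewrite e_m ?mul0r.
  rewrite big_ord_recr/= big1 ?add0r; last first.
    by move=> i _; rewrite /e ltn_eqF ?mul0r.
  by rewrite /e eqxx mul1r.
have := vw (e, J e); rewrite /= inner_jacobi; last by exists m.+1 => n; exact: e_m.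
rewrite !ee => h; apply: (can_inj (@conjcK R)); rewrite h//.
by apply: finsupp_minimal_operator; exists m.+1 => n; exact: e_m.
Qed.

(** Row zero of the Jacobi matrix forces the ratio of the first two values, so
formal eigenvectors are multiples of the polynomials of the first kind. *)
Lemma jacobi_eigen z v : J v = (fun n => z * v n) <->
  forall n, v n = v 0 * orthopoly1 a b n z.
Proof.
have [p00 p01 prec] := solution_fromP a z 1 ((z - (a 0)%:C) / (b 0)%:C) b_gt0.
have bC n : (b n)%:C != 0 :> R[i] by rewrite fmorph_eq0 gt_eqF.
have b01 : (b 0)%:C * orthopoly1 a b 1 z = z - (a 0)%:C.
  by rewrite /orthopoly1 p01 mulrCA divff// mulr1.
have p_0 : orthopoly1 a b 0 z = 1 by [].
split=> [Jv|vp]; last first.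
  apply/funext => -[|n]; rewrite /jacobi_action.
    rewrite (vp 1) mulrCA b01; ring.
  rewrite !(vp n.+2) !(vp n.+1) !(vp n).
  have /= := prec n.+1 isT; rewrite -!/(orthopoly1 _ _ _ _) => e.
  by rewrite mulrCA [(a _)%:C * _]mulrCA [(b n)%:C * _]mulrCA -!mulrDr e mulrCA.
suff H n : v n = v 0 * orthopoly1 a b n z /\ v n.+1 = v 0 * orthopoly1 a b n.+1 z.
  by move=> n; have [] := H n.
elim: n => [|n [IH0 IH1]]; split=> //.
- by rewrite p_0 mulr1.
- apply: (mulfI (bC 0)); rewrite mulrCA b01.
  have := congr1 (fun f => f 0) Jv; rewrite /jacobi_action addr0 => h.
  by apply/eqP; rewrite -subr_eq0; apply/eqP; rewrite mulrBr [v 0 * z]mulrC -h; ring.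
- apply: (mulfI (bC n.+1)); rewrite mulrCA.
  have := congr1 (fun f => f n.+1) Jv; rewrite /jacobi_action IH0 IH1 => h.
  have /= := prec n.+1 isT; rewrite -!/(orthopoly1 _ _ _ _) => e.
  have -> : (b n.+1)%:C * orthopoly1 a b n.+2 z = z * orthopoly1 a b n.+1 z -
    (a n.+1)%:C * orthopoly1 a b n.+1 z - (b n)%:C * orthopoly1 a b n z.
    by rewrite -e; ring.
  transitivity (z * (v 0 * orthopoly1 a b n.+1 z) -
    (a n.+1)%:C * (v 0 * orthopoly1 a b n.+1 z) - (b n)%:C * (v 0 * orthopoly1 a b n z)).
    by rewrite -h; ring.
  ring.
Qed.

Lemma adjoint_eigenspace_dim1 z : ell2 (orthopoly1 a b ^~ z) ->
  ell2 (fun n => z * orthopoly1 a b n z) ->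
  has_dim (adjoint_eigenspace (minimal_operator a b) z) 1.
Proof.
move=> p2 zp2; exists (fun _ n => orthopoly1 a b n z); split.
- move=> _; rewrite /adjoint_eigenspace/=.
  have <- : J (orthopoly1 a b ^~ z) = (fun n => z * orthopoly1 a b n z).
    by apply/jacobi_eigen => n; rewrite {2}/orthopoly1 /solution_from/= mul1r.
  apply: adjoint_jacobi => //; suff -> : J (orthopoly1 a b ^~ z) =
    (fun n => z * orthopoly1 a b n z) by [].
  by apply/jacobi_eigen => n; rewrite {2}/orthopoly1 /solution_from/= mul1r.
- move=> c /(_ 0); rewrite big_ord1 /orthopoly1 /solution_from/= mulr1 => c0 i.
  by rewrite ord1.
- move=> u /adjoint_minimal_operatorE/esym/jacobi_eigen uE; exists (fun=> u 0) => n.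
  by rewrite big_ord1.
Qed.

Lemma limit_circle_of_ell2_eigen : ell2 (orthopoly1 a b ^~ 'i) ->
  ell2 (orthopoly1 a b ^~ (- 'i)) -> limit_circle a b.
Proof.
have ell2Z z : normc z = 1 -> forall u : nat -> R[i], ell2 u ->
    ell2 (fun n => z * u n).
  move=> z1 u /ell2P[M uM]; apply/ell2P; exists M => n; apply: le_trans (uM n).
  by rewrite ler_sum// => j _; rewrite normcM z1 mul1r.
have i1 : normc ('i : R[i]) = 1 by rewrite /normc/= expr0n/= add0r expr1n sqrtr1.
move=> pi pni; split; first exact: minimal_operator_symmetric.
split; apply: adjoint_eigenspace_dim1 => //; apply: ell2Z => //.
by rewrite normc_opp.
Qed.

End LimitCircle.
(** * Growth of the entries of the Nevanlinna matrix *)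

Section EntryGrowth.
Local Open Scope complex_scope.
Variable R : realType.

(** A lower bound on the fourth power of the modulus passes to the limit. *)
Lemma ccvg_lb4 (s : nat -> R[i]) l (m : R) : 0 <= m -> ccvg s l ->
  (\forall n \near \oo, m <= normc (s n) ^+ 4) -> m <= normc l ^+ 4.
Proof.
move=> m0 sl sm; pose t := m `^ (4%:R^-1).
have t0 : 0 <= t by exact: powR_ge0.
have tE : t ^+ 4 = m.
  by rewrite -powR_mulrn// -powRrM mulVf ?powRr1// pnatr_eq0.
rewrite -tE lerXn2r ?nnegrE ?normc_ge0//; apply: (ccvg_lb sl).
apply: filterS sm => n; rewrite -tE => h.
by rewrite -(@ler_pXn2r _ 4) ?nnegrE ?normc_ge0.
Qed.

Lemma ln1D_le_powR (x al : R) : 0 <= x -> 0 < al -> al <= 1 ->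
  ln (1 + x) <= (1 + al^-1) * x `^ al.
Proof.
move=> x0 al0 al1; have [->|xneq0] := eqVneq x 0.
  by rewrite addr0 ln1 mulr_ge0 ?powR_ge0// addr_ge0// invr_ge0 ltW.
have {xneq0}x0 : 0 < x by rewrite lt0r xneq0.
have V0 : 0 <= al^-1 by rewrite invr_ge0 ltW.
have [x1|x1] := lerP x 1.
  apply: (@le_trans _ _ x); first by rewrite le_ln1Dx// (lt_trans _ x0).
  apply: (@le_trans _ _ (x `^ al)); first by rewrite ger1_powR// x0.
  by rewrite ler_peMl ?powR_ge0// lerDl.
apply: (@le_trans _ _ (ln (x * 2))).
  rewrite ler_ln ?posrE ?mulr_gt0 ?addr_gt0//; lra.
rewrite lnM ?posrE// mulrDl mul1r [leRHS]addrC lerD//.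
  rewrite -ler_pdivrMl ?invr_gt0// invrK -ln_powR.
  exact/ltW/ln_sublinear/powR_gt0.
apply: (@le_trans _ _ 1).
  have := @le_ln1Dx R 1; rewrite -[1 + 1]/(2%:R); apply.
  by rewrite (lt_trans _ (ltr01 : 0 < 1)).
rewrite -(powRr0 x); apply: ler_powR; exact: ltW.
Qed.

Lemma prod_le_expR (g : nat -> R) (al M r : R) n : (forall j, 0 <= g j) ->
  0 <= r -> 0 < al -> al <= 1 -> \sum_(j < n) g j `^ al <= M ->
  \prod_(j < n) (1 + r * g j) <= expR ((1 + al^-1) * M * r `^ al).
Proof.
move=> g0 r0 al0 al1 gM.
have rg0 j : 0 <= r * g j by rewrite mulr_ge0.
apply: (@le_trans _ _ (expR (\sum_(j < n) ln (1 + r * g j)))).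
  rewrite expR_sum; apply: ler_prod => j _.
  have d0 : 0 < 1 + r * g j by rewrite ltr_wpDr.
  by rewrite ltW//= lnK.
rewrite ler_expR; have c0 : 0 <= 1 + al^-1 by rewrite addr_ge0// invr_ge0 ltW.
apply: (@le_trans _ _ (\sum_(j < n) (1 + al^-1) * (g j `^ al * r `^ al))).
  rewrite ler_sum// => j _; rewrite (le_trans (ln1D_le_powR (rg0 j) al0 al1))//.
  by rewrite powRM// [r `^ al * _]mulrC.
by rewrite -mulr_sumr -mulrA ler_wpM2l// -mulr_suml ler_wpM2r// powR_ge0.
Qed.

Variables (a b : nat -> R) (k : int).
Hypothesis b_gt0 : forall n, 0 < b n.
Hypothesis b_sum : cvgn (series (fun n => (b n)^-1)).
Hypothesis sol_bound : forall u : nat -> R[i], recurrence_solution a b 0 u ->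
     (fun n => normc (u n)) =O_\oo
       (fun n => b (absz (n%:Z + k)) `^ (- 2^-1)).

Let p := p0 a b.
Let q := q0 a b.

Lemma b_sum1 : cvgn (series (fun n => b n `^ (- 1))).
Proof.
suff -> : (fun n => b n `^ (- 1)) = (fun n => (b n)^-1) by [].
by apply/funext => n; rewrite powR_inv1// ltW.
Qed.

Lemma jump_sum_bounded : exists H : R, 1 <= H /\
  forall n, \sum_(j < n) jump p q j <= H.
Proof.
have [M jM] := jump_powR_sum b_gt0 sol_bound ltr01 b_sum1.
exists (Num.max 1 M); split=> [|n]; first by rewrite le_max lexx.
rewrite le_max; apply/orP; right; rewrite (le_trans _ (jM n))//.
by rewrite ler_sum// => j _; rewrite powRr1// jump_ge0.
Qed.

Section Solution.
Variables (z : R[i]) (x0 y0 : R[i]) (u : nat -> R[i]).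
Hypothesis xy0 : normc x0 + normc y0 = 1.
Let X := canonX a b z x0 u.
Let Y := canonY a b z y0 u.
Hypothesis can : canonical_sol p q z u X Y.

Lemma canonX0 : X 0 = x0.
Proof. by rewrite /X /canonX big_ord0 mulr0 addr0. Qed.

Lemma canonY0 : Y 0 = y0.
Proof. by rewrite /Y /canonY big_ord0 mulr0 addr0. Qed.

Lemma canon_ub (al M : R) n : 0 < al -> al <= 1 ->
  \sum_(j < n) jump p q j `^ al <= M ->
  normc (X n) + normc (Y n) <= expR ((1 + al^-1) * M * normc z `^ al).
Proof.
move=> al0 al1 jM; rewrite (le_trans (canonical_sol_ub can n))//.
rewrite canonX0 canonY0 xy0 mul1r prod_le_expR ?normc_ge0// => j.
exact: jump_ge0.
Qed.

Lemma canon_bounded : exists E : R, forall n, normc (X n) + normc (Y n) <= E.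
Proof.
have [M jM] := jump_powR_sum b_gt0 sol_bound ltr01 b_sum1.
exists (expR ((1 + 1^-1) * M * normc z `^ 1)) => n; exact: canon_ub.
Qed.

Lemma canon_summable :
  summable (fun j => (p j)%:C * u j) /\ summable (fun j => (q j)%:C * u j).
Proof.
have [H [_ jH]] := jump_sum_bounded; have [E XYE] := canon_bounded.
have E0 : 0 <= E by apply: le_trans (XYE 0); rewrite addr_ge0 ?normc_ge0.
have main n : \sum_(j < n) (normc ((p j)%:C * u j) + normc ((q j)%:C * u j)) <= H * E.
  apply: (@le_trans _ _ (\sum_(j < n) jump p q j * E)); last first.
    by rewrite -mulr_suml ler_wpM2r.
  rewrite ler_sum// => j _; rewrite (le_trans (canonical_sol_jump can j))//.
  by rewrite ler_wpM2l// jump_ge0.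
split; exists (H * E) => n; apply: le_trans (main n);
  rewrite ler_sum// => j _; rewrite ?lerDl ?lerDr normc_ge0//.
Qed.

Lemma canon_ccvg :
  ccvg X (x0 + z * csum (fun j => (p j)%:C * u j)) /\
  ccvg Y (y0 + z * csum (fun j => (q j)%:C * u j)).
Proof.
have [pu qu] := canon_summable.
by split; apply: ccvg_affine; exact: summable_ccvg.
Qed.

(** For nonreal [z] the energy identity bounds the squared norm of [u]. *)
Lemma canon_ell2 : flux x0 y0 = 0 -> complex.Im z != 0 -> ell2 u.
Proof.
move=> F0 z0; have [E XYE] := canon_bounded.
have E0 : 0 <= E by apply: le_trans (XYE 0); rewrite addr_ge0 ?normc_ge0.
apply/ell2P; exists (`|complex.Im z|^-1 * (E * E)) => n.
have u0 : 0 <= \sum_(j < n) normc (u j) ^+ 2.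
  by rewrite sumr_ge0// => j _; exact: sqr_ge0.
rewrite ler_pdivlMl ?normr_gt0// -[X in _ * X]ger0_norm// -normrM.
rewrite -(flux_sum can) ?canonX0 ?canonY0// (le_trans (flux_le _ _))//.
by rewrite ler_pM ?normc_ge0// (le_trans _ (XYE n))// ?lerDl ?lerDr normc_ge0.
Qed.

End Solution.

Lemma jacobi_limit_circle : limit_circle a b.
Proof.
have F0 : flux (0 : R[i]) (-1) = 0 by rewrite /flux/= !mul0r subrr.
have xy0 : normc (0 : R[i]) + normc (-1 : R[i]) = 1.
  by rewrite normc_opp normc0 normc1 add0r.
apply: limit_circle_of_ell2_eigen => //.
  apply: (canon_ell2 xy0 (orthopoly1_canonical a b_gt0 _) F0).
  by rewrite /= oner_eq0.
apply: (canon_ell2 xy0 (orthopoly1_canonical a b_gt0 _) F0).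
by rewrite /= oppr_eq0 oner_eq0.
Qed.

(** What the order of an entry depends on: an exponential upper bound for every
summability exponent of [1 / b] in (0, 1], and a lower bound on the positive imaginary axis
by the products over [1 + 2 * r / b j]. The first two [b j] are left out, which is
harmless for growth. *)
Definition entry_growth (f : R[i] -> R[i]) :=
  (forall al : R, 0 < al -> al <= 1 -> cvgn (series (fun n => b n `^ (- al))) ->
     exists K : R, forall z, normc (f z) <= expR (K * normc z `^ al)) /\
  (exists C r0 : R, 0 < C /\ forall r n, r0 <= r ->
     \prod_(j < n) (1 + 2 * r / b j.+2) <= C * normc (f (0 +i* r)) ^+ 4).

Lemma entry_growth_canon (x0 y0 : R[i]) (u : R[i] -> nat -> R[i]) (c : R) :
  normc x0 + normc y0 = 1 -> flux x0 y0 = 0 ->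
  (forall z, canonical_sol p q z (u z) (canonX a b z x0 (u z)) (canonY a b z y0 (u z))) ->
  0 < c -> (forall z, c <= normc (u z 0) ^+ 2 + normc (u z 1) ^+ 2) ->
  entry_growth (fun z => x0 + z * csum (fun j => (p j)%:C * u z j)) /\
  entry_growth (fun z => y0 + z * csum (fun j => (q j)%:C * u z j)).
Proof.
move=> xy0 F0 can c0 cu.
have up al : 0 < al -> al <= 1 -> cvgn (series (fun n => b n `^ (- al))) ->
    exists K : R, forall z n,
    normc (canonX a b z x0 (u z) n) + normc (canonY a b z y0 (u z) n) <=
    expR (K * normc z `^ al).
  move=> al0 al1 bal; have [M jM] := jump_powR_sum b_gt0 sol_bound al0 bal.
  by exists ((1 + al^-1) * M) => z n; apply: canon_ub.
have [H [H1 jH]] := jump_sum_bounded.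
have low (r : R) n : Num.max 1 c^-1 <= r ->
    \prod_(j < n) (1 + 2 * r / b j.+2) <=
      16 * H ^+ 2 / c ^+ 2 * normc (canonX a b (0 +i* r) x0 (u (0 +i* r)) n.+3) ^+ 4 /\
    \prod_(j < n) (1 + 2 * r / b j.+2) <=
      16 * H ^+ 2 / c ^+ 2 * normc (canonY a b (0 +i* r) y0 (u (0 +i* r)) n.+3) ^+ 4.
  rewrite ge_max => /andP[r1 cr].
  have rc : 1 <= r * c by rewrite -ler_pdivrMr// mul1r.
  have x01 : normc (canonX a b (0 +i* r) x0 (u (0 +i* r)) 0) <= 1.
    by rewrite canonX0 -xy0 lerDl normc_ge0.
  have y01 : normc (canonY a b (0 +i* r) y0 (u (0 +i* r)) 0) <= 1.
    by rewrite canonY0 -xy0 lerDr normc_ge0.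
  have F00 : flux (canonX a b (0 +i* r) x0 (u (0 +i* r)) 0)
      (canonY a b (0 +i* r) y0 (u (0 +i* r)) 0) = 0.
    by rewrite canonX0 canonY0.
  have [hX hY] := canonical_sol_lb b_gt0 (wronskian0 a b_gt0) H1 jH r1
    (can _) F00 x01 y01 (cu _) rc n.
  have c20 : 0 < c ^+ 2 by rewrite exprn_gt0.
  by split; rewrite mulrAC ler_pdivlMr// mulrC.
have C0 : 0 < 16 * H ^+ 2 / c ^+ 2.
  by rewrite divr_gt0 ?exprn_gt0// mulr_gt0// exprn_gt0// (lt_le_trans ltr01).
have lowlim (r : R) n (s : nat -> R[i]) l : Num.max 1 c^-1 <= r -> ccvg s l ->
    (forall m, \prod_(j < m) (1 + 2 * r / b j.+2) <=
      16 * H ^+ 2 / c ^+ 2 * normc (s m.+3) ^+ 4) ->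
    \prod_(j < n) (1 + 2 * r / b j.+2) <= 16 * H ^+ 2 / c ^+ 2 * normc l ^+ 4.
  rewrite ge_max => /andP[r1 _] sl sm.
  have r0 : 0 <= r := le_trans ler01 r1.
  have t1 j : 1 <= 1 + 2 * r / b j.
    by rewrite lerDl divr_ge0 ?mulr_ge0// ltW.
  have P0 m : 0 <= \prod_(j < m) (1 + 2 * r / b j.+2).
    by apply: prodr_ge0 => j _; exact: le_trans ler01 (t1 _).
  rewrite -ler_pdivrMl//; apply: (ccvg_lb4 _ sl).
    by rewrite mulr_ge0// invr_ge0 ltW.
  exists n.+3 => // -[//|[//|[//|m]]] /=; rewrite 3!ltnS => nm.
  rewrite ler_pdivrMl// (le_trans _ (sm m))//.
  elim: m nm => [|m IHm]; first by rewrite leqn0 => /eqP ->.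
  rewrite leq_eqVlt ltnS => /orP[/eqP -> //|nm].
  by rewrite (le_trans (IHm nm))// big_ord_recr/= ler_peMr ?P0 ?t1.
split; split.
- move=> al al0 al1 bal; have [K KP] := up al al0 al1 bal; exists K => z.
  apply: (ccvg_ub (canon_ccvg xy0 (can z)).1); apply: nearW => n.
  by rewrite (le_trans _ (KP z n))// lerDl normc_ge0.
- exists (16 * H ^+ 2 / c ^+ 2), (Num.max 1 c^-1); split=> // r n rc.
  apply: (lowlim r n _ _ rc (canon_ccvg xy0 (can (0 +i* r))).1) => m.
  by have [] := low r m rc.
- move=> al al0 al1 bal; have [K KP] := up al al0 al1 bal; exists K => z.
  apply: (ccvg_ub (canon_ccvg xy0 (can z)).2); apply: nearW => n.
  by rewrite (le_trans _ (KP z n))// lerDr normc_ge0.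
- exists (16 * H ^+ 2 / c ^+ 2), (Num.max 1 c^-1); split=> // r n rc.
  apply: (lowlim r n _ _ rc (canon_ccvg xy0 (can (0 +i* r))).2) => m.
  by have [] := low r m rc.
Qed.

Lemma nevanlinna_entry_growth i j :
  entry_growth (fun z => nevanlinna_matrix a b z i j).
Proof.
have [gC gA] : entry_growth (nevanlinnaC a b) /\ entry_growth (nevanlinnaA a b).
  have -> : nevanlinnaC a b = (fun z => 1 + z * csum (fun j => (p j)%:C * orthopoly2 a b j z)).
    apply/funext => z; rewrite /nevanlinnaC; congr (_ + _ * csum _).
    by apply/funext => n; rewrite p0E.
  have -> : nevanlinnaA a b = (fun z => 0 + z * csum (fun j => (q j)%:C * orthopoly2 a b j z)).
    apply/funext => z; rewrite /nevanlinnaA add0r; congr (_ * csum _).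
    by apply/funext => n; rewrite q0E.
  apply: (@entry_growth_canon 1 0 (fun z => orthopoly2 a b ^~ z) ((b 0)^-1 ^+ 2)).
  - by rewrite normc0 normc1 addr0.
  - by rewrite /flux/= mulr0 mul0r subrr.
  - by move=> z; exact: orthopoly2_canonical.
  - by rewrite exprn_gt0// invr_gt0.
  - move=> z; have -> : orthopoly2 a b 0 z = 0 by [].
    have -> : orthopoly2 a b 1 z = (b 0)%:C^-1 by [].
    by rewrite normc0 expr0n add0r normcV normc_real ger0_norm// ltW.
have [gD gB] : entry_growth (nevanlinnaD a b) /\ entry_growth (nevanlinnaB a b).
  have -> : nevanlinnaD a b = (fun z => 0 + z * csum (fun j => (p j)%:C * orthopoly1 a b j z)).
    apply/funext => z; rewrite /nevanlinnaD add0r; congr (_ * csum _).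
    by apply/funext => n; rewrite p0E.
  have -> : nevanlinnaB a b = (fun z => -1 + z * csum (fun j => (q j)%:C * orthopoly1 a b j z)).
    apply/funext => z; rewrite /nevanlinnaB; congr (_ + _ * csum _).
    by apply/funext => n; rewrite q0E.
  apply: (@entry_growth_canon 0 (-1) (fun z => orthopoly1 a b ^~ z) 1) => //.
  - by rewrite normc_opp normc0 normc1 add0r.
  - by rewrite /flux/= !mul0r subrr.
  - by move=> z; exact: orthopoly1_canonical.
  - move=> z; have -> : orthopoly1 a b 0 z = 1 by [].
    by rewrite normc1 expr1n lerDl sqr_ge0.
have -> : (fun z => nevanlinna_matrix a b z i j) =
  if i == 0 then (if j == 0 then nevanlinnaA a b else nevanlinnaC a b)
  else (if j == 0 then nevanlinnaB a b else nevanlinnaD a b).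
  by apply/funext => z; rewrite /nevanlinna_matrix mxE; case: ifP; case: ifP.
by case: ifP; case: ifP.
Qed.

End EntryGrowth.
(** * Order, type and convergence exponent *)

Section OrderOfGrowth.
Local Open Scope complex_scope.
Variable R : realType.

Lemma limf_esup_le (g : R -> R) (c : R) :
  (\forall r \near +oo%R, g r <= c) -> (limf_esup (fun r => (g r)%:E) +oo%R <= c%:E)%E.
Proof.
move=> gc; rewrite limf_esupE.
apply: (@le_trans _ _ (ereal_sup ((fun r => (g r)%:E) @` [set r | g r <= c]))).
  by apply: ereal_inf_lbound; exists [set r | g r <= c].
by apply: ge_ereal_sup => _ [r /= rc <-]; rewrite lee_fin.
Qed.

Lemma limf_esup_lt (g : R -> R) (l : R) :
  (limf_esup (fun r => (g r)%:E) +oo%R < l%:E)%E ->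
  exists c : R, c < l /\ \forall r \near +oo%R, g r <= c.
Proof.
rewrite limf_esupE => /ereal_inf_lt[_ [V Voo <-]] Vl.
have gV r : V r -> ((g r)%:E <= ereal_sup ((fun r => (g r)%:E) @` V))%E.
  by move=> Vr; apply: ereal_sup_ubound; exists r.
move: Vl gV; case: (ereal_sup _) => [s| |] //= sl gV.
  by exists s; split=> //; apply: filterS Voo => r /gV; rewrite lee_fin.
exists (l - 1); split; first by rewrite ltrBlDr ltrDl.
by apply: filterS Voo => r /gV.
Qed.

(** Monotonicity of [ln] which also covers nonpositive [x], where [ln x] is [0]. *)
Lemma le_ln_ge1 (x y : R) : x <= y -> 1 <= y -> ln x <= ln y.
Proof.
move=> xy y1; have [x0|x0] := lerP x 0; first by rewrite (ln0 x0) ln_ge0.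
by rewrite ler_ln ?posrE// (lt_le_trans x0).
Qed.

Section MaxModulus.
Variables (f : R[i] -> R[i]) (r : R).
Hypothesis r0 : 0 <= r.

Lemma normc_imag : normc (0 +i* r) = r.
Proof. by rewrite /normc/= expr0n/= add0r sqrtr_sqr ger0_norm. Qed.

Lemma max_modulus_le (U : R) : (forall z, normc z = r -> normc (f z) <= U) ->
  max_modulus f r <= U.
Proof.
move=> fU; apply: ge_sup.
  by exists (normc (f (0 +i* r))), (0 +i* r) => //=; exact: normc_imag.
by move=> _ [z /= zr <-]; exact: fU.
Qed.

Lemma le_max_modulus (U : R) : (forall z, normc z = r -> normc (f z) <= U) ->
  normc (f (0 +i* r)) <= max_modulus f r.
Proof.
move=> fU; apply: ub_le_sup; last by exists (0 +i* r) => //=; exact: normc_imag.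
by exists U => _ [z /= zr <-]; exact: fU.
Qed.

End MaxModulus.

(** If the logarithms of the products over [1 + 2 * r / b j] are [O(r ^ c)] then
[b ^ (- be)] is summable for every [be > c]. Each [b j] is compared with the
first radius [r1 * 2 ^ i] above it, where its logarithm is at least [ln 3], and
the bounds at the radii [r1 * 2 ^ i], weighted by [2 ^ (- be * i)], add up to a
geometric series. *)
Lemma dyadic_summable (b : nat -> R) (B C c be r1 : R) :
  (forall j, 0 < b j) -> (forall j, (b j)^-1 <= B) -> 1 <= r1 -> 0 <= C ->
  0 < c -> c < be ->
  (forall r n, r1 <= r -> \sum_(j < n) ln (1 + 2 * r / b j) <= C * r `^ c) ->
  cvgn (series (fun j => b j `^ (- be))).
Proof.
move=> b0 bB r1_ge1 C0 c0 cbe Sle.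
have r10 : 0 < r1 := lt_le_trans ltr01 r1_ge1.
have be0 : 0 < be := lt_trans c0 cbe.
have r2_ge1 i : 1 <= (2 : R) ^+ i by rewrite exprn_ege1// ler1n.
have r2 i : 0 < (2 : R) ^+ i by rewrite exprn_gt0.
have ex_i j : exists i, b j <= r1 * 2 ^+ i.
  exists (Num.bound (b j)); apply: (@le_trans _ _ (2 ^+ Num.bound (b j))).
    apply: (@le_trans _ _ (Num.bound (b j))%:R).
      by apply/ltW/archi_boundP/ltW.
    by rewrite -natrX ler_nat ltnW// ltn_expl.
  by rewrite ler_peMl// ltW.
(* Index of the first dyadic radius above [b j]. *)
pose i_ j := ex_minn (ex_i j).
have i_le j : b j <= r1 * 2 ^+ (i_ j) by rewrite /i_; case: ex_minnP.
have i_gt j m : i_ j = m.+1 -> r1 * 2 ^+ m < b j.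
  rewrite /i_; case: ex_minnP => i _ imin im; rewrite ltNge; apply/negP => /imin.
  by rewrite im ltnn.
pose v : R := 2 `^ (- be).
have v0 : 0 < v by rewrite powR_gt0.
pose K0 := Num.max (B `^ be) (r1 `^ (- be) * v^-1).
have bV j : b j `^ (- be) = (b j)^-1 `^ be.
  by rewrite -[(b j)^-1]powR_inv1 ?ltW// -powRrM mulN1r.
have B0 : 0 <= B by apply: le_trans (bB 0); rewrite invr_ge0 ltW.
have K0_ge0 : 0 <= K0 by rewrite le_max powR_ge0.
have vE m : v ^+ m = ((2 : R) ^+ m) `^ (- be).
  by rewrite /v -powR_mulrn ?powR_ge0// powRAC powR_mulrn.
have pointwise j : b j `^ (- be) <= K0 * v ^+ (i_ j).
  case ij: (i_ j) => [|m].
    rewrite expr0 mulr1 le_max bV; apply/orP; left.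
    apply: ge0_ler_powR; rewrite ?nnegrE//; first exact: ltW.
    by rewrite invr_ge0 ltW.
  apply: (@le_trans _ _ (r1 `^ (- be) * v^-1 * v ^+ m.+1)).
    have r2m : 0 < r1 * 2 ^+ m by rewrite mulr_gt0.
    rewrite -mulrA exprS mulKf ?gt_eqF// vE -powRM ?(ltW r10) ?(ltW (r2 m))//.
    rewrite powRN powRN lef_pV2 ?posrE ?powR_gt0//.
    apply: ge0_ler_powR; rewrite ?nnegrE ?(ltW be0) ?(ltW r2m) ?(ltW (b0 j))//.
    exact/ltW/i_gt.
  by rewrite ler_wpM2r ?exprn_ge0 ?(ltW v0)// le_max lexx orbT.
pose L : R := ln 3.
have L0 : 0 < L by rewrite ln_gt0// ltr1n.
have t_ge0 i j : 0 <= 2 * (r1 * 2 ^+ i) / b j.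
  by rewrite divr_ge0 ?(ltW (b0 j))// mulr_ge0// mulr_ge0 ?(ltW r10)// ltW.
have ln_ge0' i j : 0 <= ln (1 + 2 * (r1 * 2 ^+ i) / b j).
  by rewrite ln_ge0// lerDl.
pose x := v * 2 `^ c.
have x0 : 0 <= x by rewrite mulr_ge0 ?powR_ge0.
have x1 : x < 1.
  rewrite /x /v -powRD ?pnatr_eq0 ?implybT//.
  rewrite /powR pnatr_eq0/= expR_lt1 pmulr_llt0 ?ln_gt0 ?ltr1n//; lra.
apply: (@bounded_series_cvg _ _ (K0 / L * (C * r1 `^ c / (1 - x)))).
  by move=> n; exact: powR_ge0.
move=> n; pose I := (\max_(j < n) i_ j).+1.
apply: (@le_trans _ _ (\sum_(j < n) K0 / L *
   \sum_(i < I) v ^+ i * ln (1 + 2 * (r1 * 2 ^+ i) / b j))).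
  apply: ler_sum => j _; apply: le_trans (pointwise j) _.
  rewrite -mulrA ler_wpM2l//.
  have ijI : (i_ j < I)%N by rewrite ltnS (leq_bigmax j).
  rewrite (bigD1 (Ordinal ijI))//= mulrC ler_pdivlMr//.
  rewrite ler_wpDr// ?sumr_ge0//.
    by move=> i _; rewrite mulr_ge0 ?exprn_ge0// ltW.
  rewrite ler_wpM2l ?exprn_ge0 ?(ltW v0)// /L le_ln_ge1//; last by rewrite lerDl.
  have : 1 <= r1 * 2 ^+ i_ j / b j by rewrite ler_pdivlMr ?mul1r.
  rewrite -mulrA; lra.
rewrite -mulr_sumr ler_wpM2l ?divr_ge0 ?(ltW L0)//.
rewrite exchange_big/=.
apply: (@le_trans _ _ (\sum_(i < I) C * r1 `^ c * x ^+ i)).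
  apply: ler_sum => i _; rewrite -mulr_sumr.
  apply: (@le_trans _ _ (v ^+ i * (C * (r1 * 2 ^+ i) `^ c))).
    rewrite ler_wpM2l ?exprn_ge0 ?(ltW v0)//; apply: Sle.
    by rewrite ler_peMr// ltW.
  rewrite powRM ?(ltW r10) ?(ltW (r2 _))// /x exprMn.
  have -> : (2 ^+ i) `^ c = (2 `^ c) ^+ i :> R.
    by rewrite -[RHS]powR_mulrn ?powR_ge0// powRAC powR_mulrn.
  by rewrite le_eqVlt; apply/orP; left; apply/eqP; ring.
rewrite -mulr_sumr ler_wpM2l ?mulr_ge0 ?powR_ge0// -[(1 - x)^-1]mul1r.
rewrite ler_pdivlMr ?subr_gt0//.
have := subrX1 x I; have : 0 <= x ^+ I by rewrite exprn_ge0.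
lra.
Qed.

Variable b : nat -> R.
Hypothesis b_gt0 : forall n, 0 < b n.
Hypothesis b_sum : cvgn (series (fun n => (b n)^-1)).

Let b_normE al : (fun n => `|b n| `^ (- al)) = (fun n => b n `^ (- al)).
Proof. by apply/funext => n; rewrite gtr0_norm. Qed.

Lemma convergence_exponent_bounds :
  (0 <= convergence_exponent b)%E /\ (convergence_exponent b <= 1%:E)%E.
Proof.
split.
  by apply: le_ereal_inf_tmp => _ [al [/ltW al0 _] <-]; rewrite lee_fin.
apply: ereal_inf_lbound; exists 1 => //; split=> //.
by rewrite b_normE; exact: b_sum1.
Qed.

Lemma convergence_exponentE : exists rho : R,
  [/\ rho%:E = convergence_exponent b, 0 <= rho, rho <= 1,
      forall al, rho < al -> exists2 al', 0 < al' <= al & al' <= 1 /\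
        cvgn (series (fun n => b n `^ (- al')))
    & forall al, 0 < al -> cvgn (series (fun n => b n `^ (- al))) -> rho <= al].
Proof.
have [e0 e1] := convergence_exponent_bounds.
exists (fine (convergence_exponent b)).
have fin : convergence_exponent b \is a fin_num.
  by rewrite ge0_fin_numE// (le_lt_trans e1)// ltry.
split.
- by rewrite fineK.
- exact: fine_ge0.
- by rewrite -lee_fin fineK.
- move=> al; rewrite -lte_fin fineK// => /ereal_inf_lt[_ [be [be0 bbe] <-]].
  rewrite lte_fin => beal; have [be1|be1] := lerP be 1.
    by exists be; rewrite ?be0 ?(ltW beal)// -b_normE.
  exists 1; first by rewrite ltr01 (ltW (lt_trans be1 beal)).
  by split=> //; exact: b_sum1.
- move=> al al0 bal; rewrite -lee_fin fineK//; apply: ereal_inf_lbound.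
  by exists al => //; rewrite /= b_normE.
Qed.

Lemma cvg_shift2 (be : R) : cvgn (series (fun n => b n.+2 `^ (- be))) ->
  cvgn (series (fun n => b n `^ (- be))).
Proof.
move=> /(cvg_series_bounded (fun n => powR_ge0 _ _))[M bM].
apply: (@bounded_series_cvg _ _ (b 0 `^ (- be) + (b 1 `^ (- be) + M))).
  by move=> n; exact: powR_ge0.
move=> n; apply: (@le_trans _ _ (\sum_(j < n.+2) b j `^ (- be))).
  by rewrite !big_ord_recr/= -addrA lerDl addr_ge0 ?powR_ge0.
by rewrite !big_ord_recl/= !lerD2l; exact: bM.
Qed.

Lemma inv_b_bounded : exists B : R, forall j, (b j)^-1 <= B.
Proof.
have bV j : 0 <= (b j)^-1 by rewrite invr_ge0 ltW.
have [B BP] := cvg_series_bounded bV b_sum; exists B => j.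
rewrite (le_trans _ (BP j.+1))// big_ord_recr/= lerDr sumr_ge0//.
Qed.

Variable f : R[i] -> R[i].
Hypothesis f_growth : entry_growth b f.
Variable rho : R.
Hypothesis rhoE : rho%:E = convergence_exponent b.

Lemma ln_max_modulus_ub (al : R) : 0 < al -> al <= 1 ->
  cvgn (series (fun n => b n `^ (- al))) ->
  exists K : R, 1 <= K /\ forall r, 0 <= r -> ln (max_modulus f r) <= K * r `^ al.
Proof.
move=> al0 al1 bal; have [K KP] := f_growth.1 al al0 al1 bal.
exists (Num.max 1 K); split=> [|r r0]; first by rewrite le_max lexx.
rewrite -[leRHS]expRK; apply: le_ln_ge1; last first.
  rewrite -[leLHS]expR0 ler_expR; apply: mulr_ge0; last exact: powR_ge0.
  by rewrite le_max ler01.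
apply: max_modulus_le => // z zr; rewrite (le_trans (KP z))// zr ler_expR.
by rewrite ler_wpM2r ?powR_ge0// le_max lexx orbT.
Qed.

Lemma growth_order_le (al : R) : 0 < al -> al <= 1 ->
  cvgn (series (fun n => b n `^ (- al))) -> (growth_order f <= al%:E)%E.
Proof.
move=> al0 al1 bal; have [K [K1 KP]] := ln_max_modulus_ub al0 al1 bal.
apply/lee_addgt0Pr => e e0; rewrite -EFinD; apply: limf_esup_le.
near=> r.
have r1 : 1 < r by near: r; apply: nbhs_pinfty_gt; exact: num_real.
have r0 : 0 < r := lt_trans ltr01 r1.
have rK : expR (e^-1 * ln K) <= r.
  by near: r; apply: nbhs_pinfty_ge; exact: num_real.
have lr : 0 < ln r by rewrite ln_gt0.
have K0 : 0 < K := lt_le_trans ltr01 K1.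
have Kr : 1 <= K * r `^ al.
  by rewrite mulr_ege1// -[leLHS](powRr0 r); apply: ler_powR; exact: ltW.
rewrite ler_pdivrMr//; apply: (@le_trans _ _ (ln (K * r `^ al))).
  by apply: le_ln_ge1 => //; exact: KP (ltW r0).
rewrite lnM ?posrE ?powR_gt0// ln_powR mulrDl addrC lerD2l.
by rewrite -ler_pdivrMl// -ler_expR [leRHS]lnK ?posrE.
Unshelve. all: by end_near.
Qed.

(** The maximum modulus is at least the modulus at the point ['i * r]. *)
Lemma max_modulus_lb : exists C r0 : R, [/\ 1 <= C, 1 <= r0, forall r, r0 <= r -> 0 <= max_modulus f r
  & forall r n, r0 <= r ->
  \prod_(j < n) (1 + 2 * r / b j.+2) <= C * max_modulus f r ^+ 4].
Proof.
have [K KP] := f_growth.1 1 ltr01 (lexx 1) (b_sum1 b_gt0 b_sum).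
have [C [r0 [C0 CP]]] := f_growth.2.
have fM r : 0 <= r -> normc (f (0 +i* r)) <= max_modulus f r.
  move=> r_ge0.
  by apply: (@le_max_modulus f r r_ge0 (expR (K * r `^ 1))) => z <-; exact: KP.
exists (Num.max 1 C), (Num.max 1 r0); split; rewrite ?le_max ?lexx//.
  move=> r; rewrite ge_max => /andP[r1 rr0].
  by rewrite (le_trans (normc_ge0 _) (fM r _))// (le_trans ler01).
move=> r n; rewrite ge_max => /andP[r1 rr0].
have {}fM := fM r (le_trans ler01 r1).
rewrite (le_trans (CP r n rr0))//.
apply: ler_pM; rewrite ?exprn_ge0 ?normc_ge0 ?(ltW C0) ?le_max ?lexx ?orbT//.
by rewrite lerXn2r ?nnegrE ?normc_ge0// (le_trans (normc_ge0 _) fM).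
Qed.

Lemma le_growth_order : (rho%:E <= growth_order f)%E.
Proof.
rewrite leNgt; apply/negP => /limf_esup_lt[c [crho gc]].
have [C [r0 [C1 r01 M0 Mlb]]] := max_modulus_lb.
have C0 : 0 < C := lt_le_trans ltr01 C1.
(* The maximum modulus tends to infinity, by the factor with [b 2]; hence both
   logarithms are positive and [c] is nonnegative. *)
have Mbig : \forall r \near +oo%R, [/\ 1 < r, r0 <= r & expR 1 <= max_modulus f r].
  near=> r.
  have r1 : 1 < r by near: r; apply: nbhs_pinfty_gt; exact: num_real.
  have rr0 : r0 <= r by near: r; apply: nbhs_pinfty_ge; exact: num_real.
  split=> //; rewrite leNgt; apply/negP => Me.
  have := Mlb r 1 rr0; apply/negP; rewrite -ltNge big_ord1.
  apply: (@le_lt_trans _ _ (C * expR 1 ^+ 4)).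
    rewrite ler_wpM2l ?(ltW C0)// lerXn2r ?nnegrE ?expR_ge0 ?M0//; exact: ltW.
  have re : C * expR 1 ^+ 4 * b 2 < r.
    by near: r; apply: nbhs_pinfty_gt; exact: num_real.
  apply: (@lt_trans _ _ (r / b 2)); first by rewrite ltr_pdivlMr.
  have : 0 < r / b 2 by rewrite divr_gt0// (lt_trans ltr01).
  by rewrite -mulrA; lra.
have {}gc : \forall r \near +oo%R,
    [/\ 1 < r, r0 <= r, 0 <= c & ln (max_modulus f r) <= r `^ c].
  apply: filterS2 gc Mbig => r gc [r1 rr0 Me]; have lr : 0 < ln r by rewrite ln_gt0.
  have lM1 : 1 <= ln (max_modulus f r).
    rewrite -[leLHS]expRK; apply: le_ln_ge1 => //; apply: le_trans Me.
    by rewrite -[leLHS]expR0 ler_expR.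
  have c0 : 0 <= c by apply: le_trans gc; rewrite divr_ge0 ?ln_ge0 ?(ltW r1).
  split=> //; rewrite -ler_ln ?posrE ?powR_gt0 ?(lt_trans ltr01 r1)//.
    by rewrite ln_powR -ler_pdivrMr.
  exact: lt_le_trans ltr01 lM1.
have [A [_ AP]] := gc.
have A1 : A < Num.max A 1 + 1 by rewrite (@le_lt_trans _ _ (Num.max A 1)) ?le_max ?lexx// ltrDl.
have [_ _ c_ge0 _] := AP _ A1.
have [rho' [rho'E _ _ _ rho_le]] := convergence_exponentE.
have {rho' rho'E}rho_le : forall al, 0 < al ->
    cvgn (series (fun n => b n `^ (- al))) -> rho <= al.
  by move: rho'E; rewrite -rhoE => -[<-].
(* [c1] is a positive exponent even if [c = 0], and [c1 < be < rho]. *)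
pose c1 := (c + rho) / 2; pose be := (c1 + rho) / 2.
have c1_gt0 : 0 < c1 by rewrite /c1; lra.
have cc1 : c <= c1 by rewrite /c1; lra.
have c1be : c1 < be by rewrite /be /c1; lra.
have berho : be < rho by rewrite /be /c1; lra.
move: berho; apply/negP; rewrite -leNgt; apply: rho_le; first exact: lt_trans c1be.
have [B BP] := inv_b_bounded.
apply/cvg_shift2/(@dyadic_summable (fun j => b j.+2) B (ln C + 4) c1 be (Num.max A 1 + 1)) => //.
- by rewrite lerDr le_max ler01 orbT.
- by rewrite addr_ge0// ln_ge0.
move=> r n Ar; have [r1 rr0 _ lnM_le] := AP r (lt_le_trans A1 Ar).
have r_gt0 : 0 < r := lt_trans ltr01 r1.
have d_ge1 j : 1 <= 1 + 2 * r / b j.+2.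
  by rewrite lerDl divr_ge0 ?(ltW (b_gt0 _))// mulr_ge0// ltW.
have prod_ge1 : 1 <= \prod_(j < n) (1 + 2 * r / b j.+2).
  by elim/big_ind: _ => // x y; exact: mulr_ege1.
have lnprod : \sum_(j < n) ln (1 + 2 * r / b j.+2) = ln (\prod_(j < n) (1 + 2 * r / b j.+2)).
  rewrite -[LHS]expRK expR_sum; congr ln; apply: eq_bigr => j _.
  by rewrite lnK// posrE (lt_le_trans ltr01).
have CM := Mlb r n rr0.
have M_gt0 : 0 < max_modulus f r.
  rewrite lt0r M0// andbT; apply: contraTneq (le_trans prod_ge1 CM) => ->.
  by rewrite expr0n mulr0 -ltNge ltr01.
rewrite lnprod; apply: (@le_trans _ _ (ln (C * max_modulus f r ^+ 4))).
  by apply: le_ln_ge1 => //; exact: le_trans CM.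
rewrite lnM ?posrE ?exprn_gt0// lnXn// -[_ *+ 4]mulr_natl [leRHS]mulrDl.
have rc1 : 1 <= r `^ c1 by rewrite -(powRr0 r); apply: ler_powR; exact: ltW.
apply: lerD; first by rewrite ler_peMr// ln_ge0.
rewrite ler_wpM2l// (le_trans lnM_le)//; apply: ler_powR => //; exact: ltW.
Unshelve. all: by end_near.
Qed.

Lemma growth_orderE : growth_order f = rho%:E.
Proof.
apply/eqP; rewrite eq_le le_growth_order andbT; apply/lee_addgt0Pr => e e0.
have [rho' [+ _ _ rho_lt _]] := convergence_exponentE.
rewrite -rhoE => -[rhoE']; have := rho_lt (rho + e); rewrite rhoE' ltrDl => /(_ e0).
move=> [al' /andP[al0 al_le] [al1 bal]].
by rewrite (le_trans (growth_order_le al0 al1 bal))// -EFinD lee_fin.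
Qed.

Lemma entry_finite_type (b_rho : cvgn (series (fun n => b n `^ (- rho)))) :
  finite_type_wrt rho f.
Proof.
have [rho' [+ rho_ge0 rho_le1 _ _]] := convergence_exponentE.
rewrite -rhoE => -[rhoE']; rewrite rhoE' in rho_ge0 rho_le1.
have rho_gt0 : 0 < rho.
  rewrite lt0r rho_ge0 andbT; apply/eqP => rho0.
  (* For [rho = 0] all terms of the series would be [1]. *)
  have [M bM] := cvg_series_bounded (fun n => powR_ge0 (b n) _) b_rho.
  have M0 : 0 <= M by have := bM 0; rewrite big_ord0.
  have := bM (Num.bound M); apply/negP; rewrite -ltNge rho0 oppr0.
  under eq_bigr do rewrite powRr0.
  by rewrite sumr_const card_ord; exact: archi_boundP.
have [K [K1 KP]] := ln_max_modulus_ub rho_gt0 rho_le1 b_rho.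
apply: (@le_lt_trans _ _ K%:E); last exact: ltry.
apply: limf_esup_le; near=> r.
have r0 : 0 < r by near: r; apply: nbhs_pinfty_gt; exact: num_real.
rewrite powRN ler_pdivrMl ?powR_gt0// mulrC; apply: KP; exact: ltW.
Unshelve. all: by end_near.
Qed.

End OrderOfGrowth.

Unset Implicit Arguments.

(* For n + k < 0 the index n + k is replaced by its absolute value; this
   concerns only finitely many n. *)
Theorem proposition4p13 (R : realType) (a b : nat -> R) (k : int)
  (b_gt0 : forall n, 0 < b n)
  (b_sum : cvgn (series (fun n => (b n)^-1)))
  (sol_bound : forall u : nat -> R[i], recurrence_solution a b 0 u ->
     (fun n => normc (u n)) =O_\oo
       (fun n => b (absz (n%:Z + k)) `^ (- 2^-1))) :
  limit_circle a b /\
  exists rho : R,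
    [/\ matrix_order (nevanlinna_matrix a b) rho,
        rho%:E = convergence_exponent b
      & cvgn (series (fun n => b n `^ (- rho))) ->
          matrix_finite_type (nevanlinna_matrix a b) rho].
Proof.
split; first exact: jacobi_limit_circle b_gt0 b_sum sol_bound.
have [rho [rhoE _ _ _ _]] := convergence_exponentE b_gt0 b_sum.
have growth := nevanlinna_entry_growth b_gt0 b_sum sol_bound.
exists rho; split=> //.
  by move=> i j; exact: growth_orderE b_gt0 b_sum _ (growth i j) _ rhoE.
by move=> b_rho i j; exact: entry_finite_type b_gt0 b_sum _ (growth i j) _ rhoE b_rho.
Qed.
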